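(* Let $\Pi:\mathcal R\to S\times D^m$ be an $(s,t)$ family with second $(s,t)$ frame $\mathcal F=\{\phi_1,\dots,\phi_n,t_1\phi_{n+1},\dots,t_m\phi_{n+m}\}$, and let $\mathcal I_p\subset\mathcal O_{S\times D^m}$ be the ideal sheaf of a point $p$ in the base. The cotangent space of $S\times D^m$ at $p$ is identified with $$\operatorname{Span}_{\mathcal O_{S\times D^m}}(\mathcal F)\big/\operatorname{Span}_{\mathcal I_p}(\mathcal F).$$ There is a well defined pairing between, on the one hand, Beltrami differentials supported away from the nodes on the fiber $\Pi^{-1}(p)$ and the functionals $-\frac{\pi}{t_k}\operatorname{Laur}_k$, $1\le k\le m$, and, on the other hand, the cotangent vectors at $p$; the pairing is given by forming limits (at $p$) with representatives, i.e. it depends only on the class in the quotient and not on the representing section.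
   Context: **$(s,t)$ families.** Let $R$ be a compact (possibly disconnected) Riemann surface with distinct points formally paired $\{a_k,b_k\}_{k=1}^m$, such that identifying $a_k$ with $b_k$ for all $k$ gives a connected stable curve (each component of $R-\{a_k,b_k\}$ has negative Euler characteristic). Choose local coordinates $z_k$ near $a_k$, $z_k(a_k)=0$, $w_k$ near $b_k$, $w_k(b_k)=0$, with mutually disjoint domains, and Beltrami differentials $\nu_1,\dots,\nu_n$ giving a basis of $H^{0,1}_{\bar\partial}(R,\mathcal E(K^{-1}\prod_k a_k^{-1}b_k^{-1}))$ (smooth vector fields vanishing at the $a_k,b_k$) with supports disjoint from the coordinate domains. For $s$ in a small connected neighborhood $S$ of $0\in\mathbb C^n$, $R_s$ is $R$ with the complex structure given by local solutions of $w_{\bar z}=\nu(s)w_z$, $\nu(s)=\sum_j s_j\nu_j$; the $z_k,w_k$ remain holomorphic on $R_s$. Choose $0<c<1$ with $\{|z_k|<c\},\{|w_k|<c\}$ in the coordinate domains; put $D=\{|t|<c^4\}$. Remove the discs $\{|z_k|\le c^2\},\{|w_k|\le c^2\}$ from $R_s$, and for $(s,t)\in S\times D^m$ glue, for each $k$, a copy of $\{zw=t_k,|z|<c,|w|<c\}$ by identifying $p$ with $c^2<|z_k(p)|<c$ to $(z_k(p),t_k/z_k(p))$ and $q$ with $c^2<|w_k(q)|<c$ to $(t_k/w_k(q),w_k(q))$. The resulting proper family $\Pi:\mathcal R\to S\times D^m$ is an $(s,t)$ family. The general fiber is a smooth surface of genus $\mathbf g$ and $m+n=3\mathbf g-3$.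 Near the $k$-th node, $(z_k,w_k)$ with $z_kw_k=t_k$ and the remaining base parameters $s'$ are coordinates. **Relative dualizing sheaf and $\operatorname{Laur}$.** $\omega=\omega_{\mathcal R/S\times D^m}$ is the relative dualizing sheaf, generated near the $k$-th node by $\frac{dz_k}{z_k}-\frac{dw_k}{w_k}$. A section of $\omega^2$ near the $k$-th node is $\mathbf f(z_k,w_k,s')\big(\frac{dz_k}{z_k}-\frac{dw_k}{w_k}\big)^2$, $\mathbf f=\sum_{p,q\ge0} a_{pq}(s')z_k^pw_k^q$; its residue at the node is $a_{00}(s')$ and $\operatorname{Laur}_k:=4\sum_{p\ge0}a_{pp}(s')t_k^p$, a holomorphic function on the base. $\mathcal V\subset\omega^2$ is the subsheaf of sections with vanishing residues at all nodes. **Pairing.** A Beltrami differential $\nu(z)\partial_z\otimes d\bar z$ pairs with a quadratic differential $\phi(z)dz^2$ on a fiber by $\int\nu(z)\phi(z)\,dE$, $dE$ Euclidean area. At a base point with all $t_k\neq0$, a tangent vector pairs with a section of $\Pi_*\omega^2$ through its Kodaira-Spencer class; in particular $(\partial/\partial t_k,\phi)=-\frac{\pi}{t_k}\operatorname{Laur}_k(\phi)$. **Frames and cotangents.** The base is restricted to a neighborhood of the origin on which there are sections $\phi_1,\dots,\phi_{3\mathbf g-3}$ of $\Pi_*\omega^2$, linearly independent on every fiber, with, where all $t_k\ne0$, $(\partial/\partial s_h,\phi_j)=\delta_{hj}$, $(\partial/\partial s_h,\phi_{n+k})=0$, and with $\operatorname{Laur}_k(\phi_h)=0$, $\operatorname{Laur}_k(\phi_{n+\ell})=-\delta_{k\ell}/\pi$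 ($1\le h,j\le n$, $1\le k,\ell\le m$). The second $(s,t)$ frame is $\mathcal F=\{\phi_1,\dots,\phi_n,t_1\phi_{n+1},\dots,t_m\phi_{n+m}\}$. The cotangent sheaf of $S\times D^m$ is identified with the direct image $\Pi_*\mathcal V$; on the set where all $t_k\neq 0$ this is the identification given by the pairing. *)

(* Defs.v *)
From HB Require Import structures.
From mathcomp Require Import all_boot all_order all_algebra.
From mathcomp Require Import complex.
From mathcomp Require Import all_classical all_reals all_analysis.
Set Implicit Arguments.
Unset Strict Implicit.
Unset Printing Implicit Defensive.
Import Order.TTheory GRing.Theory Num.Theory numFieldNormedType.Exports.
Local Open Scope classical_set_scope.
Local Open Scope ring_scope.

(* R[i] packaged as a structure, so that its topology and normed-module
   structure are found by unification. *)
Definition Cx (R : realType) : numClosedFieldType := R[i]%C.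

Section Plane.
Variable R : realType.
Local Notation C := (Cx R).

Definition rc (r : R) : C := (r%:C)%C.
Definition cRe (z : C) : R := complex.Re z.
Definition cIm (z : C) : R := complex.Im z.
Definition ofplane (q : R * R) : C := (q.1 +i* q.2)%C.
Definition toplane (z : C) : R * R := (cRe z, cIm z).

Definition reR (F : C -> C) (q : R * R) : R := cRe (F (ofplane q)).
Definition imR (F : C -> C) (q : R * R) : R := cIm (F (ofplane q)).

Definition rdiff (F : C -> C) (z : C) : Prop :=
  differentiable (reR F : R * R -> R^o) (toplane z) /\
  differentiable (imR F : R * R -> R^o) (toplane z).

Definition dirder (v : R * R) (F : C -> C) (z : C) : C :=
  ofplane ('D_v (reR F : R * R -> R^o) (toplane z),
           'D_v (imR F : R * R -> R^o) (toplane z)).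
Definition dx := dirder (1, 0).
Definition dy := dirder (0, 1).

(* Wirtinger derivatives d/dz and d/dzbar. *)
Definition wz (F : C -> C) (z : C) : C := (dx F z - ofplane (0, 1) * dy F z) / 2.
Definition wzb (F : C -> C) (z : C) : C := (dx F z + ofplane (0, 1) * dy F z) / 2.

Fixpoint Ck (k : nat) (D : set C) (F : C -> C) : Prop :=
  (forall z, D z -> {for z, continuous F}) /\
  (if k is k'.+1 then
     [/\ forall z, D z -> rdiff F z, Ck k' D (dx F) & Ck k' D (dy F)]
   else True).
(* Meant for open D. *)
Definition smooth (D : set C) (F : C -> C) : Prop := forall k, Ck k D F.

Definition cmeasurable (D : set C) (F : C -> C) : Prop :=
  measurable_fun (ofplane @^-1` D) (reR F) /\
  measurable_fun (ofplane @^-1` D) (imR F).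

(* Integral over D against Euclidean area. *)
Definition area_int (D : set C) (F : C -> C) : C :=
  ofplane
    (Rintegral (lebesgue_measure \x lebesgue_measure)%E (ofplane @^-1` D) (reR F),
     Rintegral (lebesgue_measure \x lebesgue_measure)%E (ofplane @^-1` D) (imR F)).

End Plane.

(* A compact, possibly disconnected Riemann surface, given by a finite
   holomorphic atlas shrunk to compact sets [core i] that still cover; the
   shrinking only serves to write integrals over the surface as finite sums of
   planar integrals. *)
Record surface (R : realType) := Surface {
  pts :> topologicalType;
  nch : nat;
  dom : 'I_nch -> set pts;
  zc : 'I_nch -> pts -> Cx R;
  zinv : 'I_nch -> Cx R -> pts;
  core : 'I_nch -> set pts;
  surf_hausdorff : hausdorff_space pts;
  surf_compact : compact [set: pts];
  dom_open : forall i, open (dom i);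
  zc_open : forall i, open (zc i @` dom i);
  zcK : forall i x, dom i x -> zinv i (zc i x) = x;
  zc_cont : forall i x, dom i x -> {for x, continuous (zc i)};
  zinv_cont : forall i x, dom i x -> {for zc i x, continuous (zinv i)};
  zc_hol : forall i j x, dom i x -> dom j x ->
    derivable (zc j \o zinv i) (zc i x) 1;
  core_compact : forall i, compact (core i);
  core_sub : forall i, core i `<=` dom i;
  core_cover : forall x, exists i, core i x }.

Section Surface.
Variables (R : realType) (X : surface R).
Local Notation C := (Cx R).
Local Notation I := ('I_(nch X)).

(* A tensor on X is a family of coefficients, one function on each [dom i]
   (values elsewhere are irrelevant). *)
Definition coef := I -> X -> C.

(* df/dz_i for a holomorphic function f. *)
Definition jac (i : I) (f : X -> C) (x : X) : C := derive1 (f \o zinv i) (zc i x).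

Definition hol_at (f : X -> C) (x : X) : Prop :=
  forall i, dom i x -> derivable (f \o zinv i) (zc i x) 1.

(* th_i dz_i, holomorphic on the open set Y *)
Definition hol_1form (Y : set X) (th : coef) : Prop :=
  (forall i x, Y x -> dom i x -> derivable (th i \o zinv i) (zc i x) 1) /\
  (forall i j x, Y x -> dom i x -> dom j x ->
     th i x = th j x * jac i (zc j) x).

(* The genus of a connected component Y is the dimension of its space of
   holomorphic 1-forms. *)
Definition has_genus (Y : set X) (g : nat) : Prop :=
  exists th : 'I_g -> coef, (forall a, hol_1form Y (th a)) /\
    forall eta, hol_1form Y eta ->
      exists! c : 'rV[C]_g, forall i x, Y x -> dom i x ->
        eta i x = \sum_a c 0 a * th a i x.

(* Transformation rules of mu d/dz (x) dzbar and of a vector field v d/dz;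
   jac i (zc j) = dz_j/dz_i. *)
Definition beltrami_rule (A : set X) (mu : coef) : Prop :=
  forall i j x, A x -> dom i x -> dom j x ->
    mu i x = mu j x * ((jac i (zc j) x)^* / jac i (zc j) x).
Definition field_rule (A : set X) (v : coef) : Prop :=
  forall i j x, A x -> dom i x -> dom j x ->
    v i x = v j x / jac i (zc j) x.

Definition smooth_coef (mu : coef) : Prop :=
  forall i, smooth (zc i @` dom i) (mu i \o zinv i).

(* mu is, near x, a local equation of x times a smooth coefficient, i.e. a
   smooth section of the bundle twisted by the inverse of the point x. *)
Definition divisible_at (x : X) (mu : coef) : Prop :=
  forall i, dom i x -> exists (D : set C) (h : C -> C),
    [/\ open D, D (zc i x), smooth D h &
        forall z, D z -> mu i (zinv i z) = (z - zc i x) * h z].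

End Surface.
Arguments coef {R} X.

(* The choices entering an (s,t) family.  The index [false] stands for the
   a-side (a_k, z_k), the index [true] for the b-side (b_k, w_k).  The base is
   sbase x {|t_k| < rad}^m with rad <= c^4, so that restrictions of the base to
   smaller neighbourhoods of the origin are of the same kind. *)
Record st_data (R : realType) (X : surface R) (n m : nat) := StData {
  mark : bool -> 'I_m -> X;
  cdom : bool -> 'I_m -> set X;
  zeta : bool -> 'I_m -> X -> Cx R;
  nu : 'I_n -> coef X;
  sbase : set 'rV[Cx R]_n;
  cst : R;
  rad : R }.

Section Family.
Variables (R : realType) (X : surface R) (n m : nat) (d : st_data X n m).
Local Notation C := (Cx R).
Local Notation I := ('I_(nch X)).
Local Notation base := ('rV[C]_n * 'rV[C]_m)%type.
Local Notation c := (rc (cst d)).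

Definition nmarks (Y : set X) : nat :=
  #|[set q : bool * 'I_m | `[< Y (mark d q.1 q.2) >]]%SET|.

(* Connectedness of the curve obtained by identifying a_k and b_k: clopen sets
   of the quotient are the saturated clopen sets of X.  The Euler
   characteristic of a component minus its marked points is 2 - 2g - #marks. *)
Definition connected_stable : Prop :=
  [/\ [set: X] !=set0,
      forall A : set X, clopen A ->
        (forall k, A (mark d false k) <-> A (mark d true k)) ->
        A = set0 \/ A = setT &
      forall x : X, exists g : nat,
        has_genus (connected_component setT x) g /\
        (2%:Z - 2%:Z * g%:Z - (nmarks (connected_component setT x))%:Z < 0)%R].

Definition local_coordinates : Prop :=
  [/\ forall e k, open (cdom d e k) /\ cdom d e k (mark d e k),
      forall e k, zeta d e k (mark d e k) = 0,
      forall e k x y, cdom d e k x -> cdom d e k y ->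
        zeta d e k x = zeta d e k y -> x = y,
      forall e k x, cdom d e k x -> hol_at (zeta d e k) x &
      forall e k e' k', (e, k) <> (e', k') ->
        cdom d e k `&` cdom d e' k' = set0].

(* Smooth sections of L = K^-1 prod a_k^-1 b_k^-1, and smooth (0,1)-forms with
   values in L. *)
Definition L_section (v : coef X) : Prop :=
  [/\ field_rule setT v, smooth_coef v &
      forall e k, divisible_at (mark d e k) v].
Definition L_form (mu : coef X) : Prop :=
  [/\ beltrami_rule setT mu, smooth_coef mu &
      forall e k, divisible_at (mark d e k) mu].
Definition dbar_exact (mu : coef X) : Prop :=
  exists v, L_section v /\
    forall i x, dom i x -> mu i x = wzb (v i \o zinv i) (zc i x).

Definition nus (s : 'rV[C]_n) : coef X :=
  fun i x => \sum_j s 0 j * nu d j i x.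

(* The second clause says that the support of nu_j is disjoint from the (open)
   coordinate domains. *)
Definition beltrami_basis : Prop :=
  [/\ forall j, L_form (nu d j),
      forall j e k i x, dom i x -> cdom d e k x -> nu d j i x = 0 &
      forall beta, L_form beta ->
        exists! s : 'rV[C]_n,
          dbar_exact (fun i x => beta i x - nus s i x)].

Definition is_st_family : Prop :=
  [/\ connected_stable, local_coordinates, beltrami_basis,
      [/\ open (sbase d), connected (sbase d), sbase d 0 &
          forall s i x, sbase d s -> dom i x -> `|nus s i x| < 1] &
      [/\ 0 < cst d < 1,
          forall e k (xi : C), `|xi| < c ->
            exists2 x, cdom d e k x & zeta d e k x = xi &
          0 < rad d <= cst d ^+ 4]].

Definition tk (k : 'I_m) (b : base) : C := b.2 0 k.
Definition Base : set base :=
  [set b | sbase d b.1 /\ forall k, `|tk k b| < rc (rad d)].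
Definition smooth_fiber (b : base) : Prop := forall k, tk k b != 0.

(* R minus the closed discs of radius c^2. *)
Definition outer : set X :=
  [set x | forall e k, cdom d e k x -> c ^+ 2 < `|zeta d e k x|].

(* The total space is outer x Base glued to the node pieces
   {(z,w,b) : |z| < c, |w| < c, zw = t_k(b)}. *)
Definition in_node (k : 'I_m) (b : base) (z w : C) : Prop :=
  [/\ `|z| < c, `|w| < c & z * w = tk k b].

Definition fz (F : X -> base -> C) (i : I) (x : X) (b : base) : C :=
  wz (fun z => F (zinv i z) b) (zc i x).

(* Holomorphic functions on (open subsets W of) the family s |-> R_s: C^1
   along the fibers, F_zbar = nu(s) F_z, and holomorphic in the base point for
   fixed x. *)
Definition total_hol (W : set (X * base)) (F : X -> base -> C) : Prop :=
  forall x b, W (x, b) ->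
    [/\ {for (x, b), continuous (fun q : X * base => F q.1 q.2)},
        differentiable (F x : base -> C^o) b &
        forall i, dom i x ->
          [/\ rdiff (fun z => F (zinv i z) b) (zc i x),
              wzb (fun z => F (zinv i z) b) (zc i x) =
                nus b.1 i x * fz F i x b &
              {for (x, b), continuous (fun q : X * base => fz F i q.1 q.2)}]].

(* Holomorphic functions whose restrictions to the fibers are local
   coordinates. *)
Definition fiber_coord (W : set (X * base)) (w : X -> base -> C) : Prop :=
  total_hol W w /\
  forall x b i, W (x, b) -> dom i x -> fz w i x b != 0.

(* Relative quadratic differentials.  On the outer piece [qo i] is the
   coefficient with respect to (dz_i + nu_i(s) dzbar_i)^2, so q dw^2 has
   coefficient q (w_{z_i})^2 when w_zbar = nu(s) w_z.  On the k-th node piece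
   [qn k z w b] is the coefficient with respect to (dz_k/z_k - dw_k/w_k)^2. *)
Record qd := Qd {
  qo : I -> X -> base -> C;
  qn : 'I_m -> C -> C -> base -> C }.

Definition qd_eq_at (b : base) (psi chi : qd) : Prop :=
  (forall i x, outer x -> dom i x -> qo psi i x b = qo chi i x b) /\
  (forall k z w, in_node k b z w -> qn psi k z w b = qn chi k z w b).
Definition qd_eq (U : set base) (psi chi : qd) : Prop :=
  forall b, U b -> qd_eq_at b psi chi.

Definition qadd (psi chi : qd) : qd :=
  Qd (fun i x b => qo psi i x b + qo chi i x b)
     (fun k z w b => qn psi k z w b + qn chi k z w b).
Definition qscale (g : base -> C) (psi : qd) : qd :=
  Qd (fun i x b => g b * qo psi i x b) (fun k z w b => g b * qn psi k z w b).
Definition qcomb (f : 'I_n + 'I_m -> base -> C) (F : 'I_n + 'I_m -> qd) : qd :=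
  Qd (fun i x b => \sum_a f a b * qo (F a) i x b)
     (fun k z w b => \sum_a f a b * qn (F a) k z w b).
Definition qzero : qd := Qd (fun _ _ _ => 0) (fun _ _ _ _ => 0).

(* Laur_k at b: 4 sum_p a_pp t_k^p for an expansion sum a_pq z^p w^q of the
   coefficient on the k-th node piece.  The expansion is only required on the
   fiber zw = t_k over b: there the a_pq are not unique but sum_p a_pp t_k^p
   (the constant Laurent coefficient) is, so this is the usual Laur_k where
   sum a_pq(s') z^p w^q converges, and it makes sense on any open set of the
   base, including those not meeting t_k = 0. *)
Definition node_expansion (k : 'I_m) (psi : qd) (b : base)
    (a : nat -> nat -> C) : Prop :=
  forall z w, in_node k b z w ->
    (exists M : C, forall N,
       \sum_(p < N) \sum_(q < N) `|a p q * z ^+ p * w ^+ q| <= M) /\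
    ((fun N => \sum_(p < N) \sum_(q < N) a p q * z ^+ p * w ^+ q) @ \oo
       --> qn psi k z w b).
Definition is_laur (k : 'I_m) (psi : qd) (b : base) (l : C) : Prop :=
  exists2 a, node_expansion k psi b a &
    ((fun N => 4 * \sum_(p < N) a p p * tk k b ^+ p) @ \oo --> l).
Definition Laur (k : 'I_m) (psi : qd) (b : base) : C :=
  xget 0 [set l | is_laur k psi b l].

Definition set_t (k : 'I_m) (b : base) (t : C) : base :=
  (b.1, \row_l (if l == k then t else b.2 0 l)).

(* Sections over U of the direct image of omega^2.  The four clauses are
   holomorphy on the outer piece, holomorphy in (z_k, w_k, s') on the node
   pieces, the expansion at the nodes, and agreement on the overlaps
   c^2 < |z_k| < c and c^2 < |w_k| < c, where dz/z - dw/w equals 2 dz/z,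
   resp. -2 dw/w. *)
Definition omega2 (U : set base) (psi : qd) : Prop :=
  [/\ forall x b, outer x -> U b ->
        exists (W : set (X * base)) (w q : X -> base -> C),
          [/\ open W, W (x, b), fiber_coord W w, total_hol W q &
              forall x' b' i, W (x', b') -> dom i x' ->
                qo psi i x' b' = q x' b' * fz w i x' b' ^+ 2],
      forall k z w b, `|z| < c -> `|w| < c -> U (set_t k b (z * w)) ->
        differentiable
          ((fun y : (C * C) * base =>
             qn psi k y.1.1 y.1.2 (set_t k y.2 (y.1.1 * y.1.2)))
             : (C^o * C^o) * base -> C^o)
          ((z, w), b),
      forall k b, U b -> exists l, is_laur k psi b l &
      forall k i x b, U b -> dom i x ->
        (cdom d false k x -> c ^+ 2 < `|zeta d false k x| < c ->
           let z := zeta d false k x in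
           qo psi i x b = 4 * qn psi k z (tk k b / z) b / z ^+ 2
                          * jac i (zeta d false k) x ^+ 2) /\
        (cdom d true k x -> c ^+ 2 < `|zeta d true k x| < c ->
           let w := zeta d true k x in
           qo psi i x b = 4 * qn psi k (tk k b / w) w b / w ^+ 2
                          * jac i (zeta d true k) x ^+ 2)].

(* Sections over U of the direct image of V: vanishing residue at the nodes. *)
Definition PiV (U : set base) (psi : qd) : Prop :=
  omega2 U psi /\
  forall k b, U b -> tk k b = 0 -> qn psi k 0 0 b = 0.

(* Beltrami differentials on a fiber.  On the outer piece [mo i] is the
   coefficient in the frame dual to (dz_i + nu_i(s) dzbar_i)^2, normalised so
   that the pairing density is [mo i * qo i] times the Euclidean area of z_i:
   the differential mu d/dw (x) dwbar on R_s has
   mo_i = mu (conj w_{z_i} / w_{z_i}) (1 - |nu_i(s)|^2).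
   On the k-th node piece [mn false k], [mn true k] are the coefficients in the
   coordinates z_k, w_k. *)
Record fbeltrami := FBeltrami {
  mo : coef X;
  mn : bool -> 'I_m -> C -> C }.

Definition annulus (k : 'I_m) (b : base) : set C :=
  [set xi | `|tk k b| < c * `|xi| /\ `|xi| < c].

(* Bounded by M on the fiber over b. *)
Definition fbel_bound (b : base) (M : C) (mu : fbeltrami) : Prop :=
  (forall i x, outer x -> dom i x -> `|mo mu i x| <= M) /\
  (forall e k xi, annulus k b xi -> `|mn mu e k xi| <= M).

(* Bounded measurable Beltrami differentials on the fiber over b. *)
Definition is_fbeltrami (b : base) (mu : fbeltrami) : Prop :=
  [/\ beltrami_rule outer (mo mu),
      forall e k i x, outer x -> dom i x -> cdom d e k x ->
        `|zeta d e k x| < c ->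
        mo mu i x = mn mu e k (zeta d e k x) *
          ((jac i (zeta d e k) x)^* / jac i (zeta d e k) x),
      forall k z w, in_node k b z w -> tk k b != 0 ->
        mn mu false k z = mn mu true k w * ((- w / z)^* / (- w / z)),
      (forall i, cmeasurable (zc i @` (dom i `&` outer)) (mo mu i \o zinv i)) /\
      (forall e k, cmeasurable (annulus k b) (mn mu e k)) &
      exists M, fbel_bound b M mu].

Definition off_nodes (b : base) (mu : fbeltrami) : Prop :=
  exists2 eps : R, 0 < eps &
    forall e k xi, tk k b = 0 -> annulus k b xi -> `|xi| < rc eps ->
      mn mu e k xi = 0.

Definition cut : C := (c + c ^+ 2) / 2.

(* The fiber over b is cut, up to null sets, into the part of R outside the
   discs |z_k|, |w_k| < cut (itself cut along the cores), and the halves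
   |z| >= |w|, |w| > |z| of the node pieces with |z|, |w| < cut. *)
Definition outer_cell (i : I) : set X :=
  [set x | [/\ core i x, forall j : I, (j < i)%N -> ~ core j x &
               forall e k, cdom d e k x -> cut <= `|zeta d e k x|]].

Definition fpair (b : base) (mu : fbeltrami) (psi : qd) : C :=
  \sum_i area_int (zc i @` outer_cell i)
           (fun z => mo mu i (zinv i z) * qo psi i (zinv i z) b) +
  \sum_k (area_int [set z | `|tk k b| <= `|z| ^+ 2 /\ `|z| < cut]
            (fun z => mn mu false k z *
                      (4 * qn psi k z (tk k b / z) b / z ^+ 2)) +
          area_int [set w | `|tk k b| < `|w| ^+ 2 /\ `|w| < cut]
            (fun w => mn mu true k w *
                      (4 * qn psi k (tk k b / w) w b / w ^+ 2))).

(* The Kodaira-Spencer representative of d/ds_h: the derivative of nu(s) in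
   s_h, which in the frame of [mo] is nu_h itself on every R_s. *)
Definition ks_s (h : 'I_n) : fbeltrami := FBeltrami (nu d h) (fun _ _ _ => 0).

Definition laur_functional (k : 'I_m) (psi : qd) (b : base) : C :=
  - rc pi / tk k b * Laur k psi b.

(* Pairing of the tangent vector v at b (all t_k nonzero) with psi, using
   (d/dt_k, psi) = - pi/t_k Laur_k psi. *)
Definition tangent_pair (b : base) (v : base) (psi : qd) : C :=
  \sum_h v.1 0 h * fpair b (ks_s h) psi +
  \sum_k v.2 0 k * laur_functional k psi b.

Definition hol_on (U : set base) (g : base -> C) : Prop :=
  forall b, U b -> differentiable (g : base -> C^o) b.

(* Cotangent vectors are written in the basis ds_j, dt_k. *)
Definition covec := ('rV[C]_n * 'rV[C]_m)%type.
Definition cot_eval (xi : covec) (v : base) : C :=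
  \sum_j xi.1 0 j * v.1 0 j + \sum_k xi.2 0 k * v.2 0 k.

Definition hol_form (U : set base) (al : base -> covec) : Prop :=
  forall b, U b -> differentiable (al : base -> 'rV[C]_n * 'rV[C]_m) b.

(* Theta U maps holomorphic 1-forms on U to sections of Pi_* V over U: an
   isomorphism of sheaves of O-modules on the base which is the one given by
   the pairing wherever all t_k are nonzero. *)
Definition cotangent_identification (Theta : set base -> (base -> covec) -> qd) :
    Prop :=
  forall U : set base, open U -> U `<=` Base ->
  [/\ (forall al, hol_form U al -> PiV U (Theta U al)) /\
      (forall al be, (forall b, U b -> al b = be b) ->
        qd_eq U (Theta U al) (Theta U be)),
      forall (g : base -> C) al be, hol_on U g -> hol_form U al ->
        hol_form U be ->
        qd_eq U (Theta U (fun b => (g b *: (al b).1 + (be b).1,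
                                    g b *: (al b).2 + (be b).2)))
                (qadd (qscale g (Theta U al)) (Theta U be)),
      (forall al be, hol_form U al -> hol_form U be ->
        qd_eq U (Theta U al) (Theta U be) -> forall b, U b -> al b = be b) /\
      (forall psi, PiV U psi -> exists2 al, hol_form U al &
        qd_eq U (Theta U al) psi),
      forall (U' : set base) al, open U' -> U' `<=` U -> hol_form U al ->
        qd_eq U' (Theta U' al) (Theta U al) &
      forall al b v, hol_form U al -> U b -> smooth_fiber b ->
        tangent_pair b v (Theta U al) = cot_eval (al b) v].

(* phi (inl j) = phi_j and phi (inr k) = phi_{n+k}. *)
Definition is_frame (phi : 'I_n + 'I_m -> qd) : Prop :=
  [/\ forall a, omega2 Base (phi a),
      forall b (x : 'I_n + 'I_m -> C), Base b ->
        qd_eq_at b (qcomb (fun a _ => x a) phi) qzero -> forall a, x a = 0,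
      forall b, Base b -> smooth_fiber b ->
        (forall h j, fpair b (ks_s h) (phi (inl j)) = (h == j)%:R) /\
        (forall h k, fpair b (ks_s h) (phi (inr k)) = 0) &
      forall b, Base b ->
        (forall k h, Laur k (phi (inl h)) b = 0) /\
        (forall k l, Laur k (phi (inr l)) b = - ((k == l)%:R / rc pi))].

Definition second_frame (phi : 'I_n + 'I_m -> qd) (a : 'I_n + 'I_m) : qd :=
  match a with
  | inl _ => phi a
  | inr k => qscale (tk k) (phi a)
  end.

(* Sections over U of Span_O(F) and Span_{I_p}(F), and the quotient module, as
   a set of cosets. *)
Definition spanO (U : set base) (F : 'I_n + 'I_m -> qd) (psi : qd) : Prop :=
  exists2 f, forall a, hol_on U (f a) & qd_eq U psi (qcomb f F).
Definition spanI (U : set base) (p : base) (F : 'I_n + 'I_m -> qd) (psi : qd) :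
    Prop :=
  exists2 f, forall a, hol_on U (f a) /\ f a p = 0 & qd_eq U psi (qcomb f F).
Definition coset U p F (psi : qd) : set qd :=
  [set chi | spanO U F chi /\ spanI U p F (qadd chi (qscale (fun=> -1) psi))].
Definition quot U p F : set (set qd) := [set coset U p F psi | psi in spanO U F].

(* The family M of Beltrami differentials on the fibers over U converges to mu
   on the fiber over p: coefficientwise, boundedly, with supports uniformly
   away from the nodes of the fiber over p. *)
Definition fbel_converges (U : set base) (p : base) (M : base -> fbeltrami)
    (mu : fbeltrami) : Prop :=
  [/\ forall b, U b -> is_fbeltrami b (M b),
      exists K, forall b, U b -> fbel_bound b K (M b),
      exists2 eps : R, 0 < eps & forall b e k xi, U b -> tk k p = 0 ->
        annulus k b xi -> `|xi| < rc eps -> `|tk k b| < rc eps * `|xi| ->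
        mn (M b) e k xi = 0,
      forall i x, outer x -> dom i x ->
        mo (M b) i x @[b --> p] --> mo mu i x &
      forall e k xi, `|tk k p| < `|xi| ^+ 2 -> `|xi| < c ->
        mn (M b) e k xi @[b --> p] --> mn mu e k xi].

End Family.

(* Main.v *)
(* The second frame is dual to the coordinate frame ds_j, dt_k where all t_k are
   nonzero, and it consists of sections of Pi_* V; since such fibers are dense,
   the cotangent identification sends ds_j and dt_k to its members everywhere.
   So sections of Pi_* V coming from 1-forms are the holomorphic combinations
   of the frame, and the class of such a section modulo the ideal of p is the
   tuple of its coefficients at p.  A functional that is linear over the base
   functions then depends only on this tuple, once its values on the frame
   converge: for Beltrami differentials supported away from the nodes this is
   dominated convergence on the charts and on the halves of the node pieces,
   and for Laur_k it is the uniqueness of the constant Laurent coefficient. *)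
Require Import Defs.
From HB Require Import structures.
From mathcomp Require Import all_boot all_order all_algebra.
From mathcomp Require Import complex.
From mathcomp Require Import all_classical all_reals all_analysis.
From mathcomp Require Import measurable_realfun ring lra.
From mathcomp Require Import cyclic separable cyclotomic.
Import Order.TTheory GRing.Theory Num.Theory numFieldNormedType.Exports.
Local Open Scope classical_set_scope.
Local Open Scope ring_scope.

(** * The complex plane *)

(** The node pieces shape the estimates. The density of the pairing there is mu times 4 f / z^2,
    singular at the node, and its domain |t_k| <= |z|^2 moves with the base point. The singularity
    is harmless because |z| stays bounded below wherever the Beltrami coefficient is nonzero: by the
    support condition if t_k(p) = 0, by |z|^2 >= |t_k| otherwise. The moving domain is handled by
    extending densities by zero to the fixed disc of radius [cut]; pointwise convergence then fails
    at most on the circle |z|^2 = |t_k(p)|, a null set. For [Laur] only expansions on one fiber are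
    given, so z and w are tied by zw = t_k. Rotating (z, w) to (uz, w/u) stays on the fiber, and a
    finite average over roots of unity takes the place of a contour integral. The factor t_k in the
    second frame acts twice: it kills the residue at the node, and it cancels the 1/t_k of the
    functional. Hence -pi/t_k Laur_k reads off, where t_k is nonzero, the coefficient of the k-th
    member t_k phi_(n+k), and a coefficient is holomorphic across t_k = 0. *)

Section PlaneTopology.
Set Implicit Arguments.
Unset Strict Implicit.
Variable R : realType.
Local Notation C := (Cx R).
Implicit Types (z w : C) (q : R * R).

Lemma ofplaneK : cancel (@ofplane R) (@toplane R).
Proof. by case. Qed.

Lemma toplaneK : cancel (@toplane R) (@ofplane R).
Proof. by case. Qed.

Lemma ler_rc (x y : R) : (rc x <= rc y) = (x <= y).
Proof. exact: lecR. Qed.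

Lemma ltr_rc (x y : R) : (rc x < rc y) = (x < y).
Proof. exact: ltcR. Qed.

Lemma rcD (x y : R) : rc (x + y) = rc x + rc y.
Proof. exact: rmorphD. Qed.

Lemma rcM (x y : R) : rc (x * y) = rc x * rc y.
Proof. exact: rmorphM. Qed.

Lemma rc_nat (n : nat) : rc (n%:R : R) = n%:R.
Proof. exact: rmorph_nat. Qed.

(** The order on [C] is partial and norms are elements of [C]; naming the real number behind a norm
    or a positive element brings back total-order reasoning. *)
Lemma normC_rc z : exists2 r : R, 0 <= r & `|z| = rc r.
Proof.
rewrite normc_def.
by exists (Num.sqrt (complex.Re z ^+ 2 + complex.Im z ^+ 2)); rewrite ?sqrtr_ge0.
Qed.

Lemma posC_rc (e : C) : 0 < e -> exists2 r : R, 0 < r & e = rc r.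
Proof.
move=> e0; exists (cRe e); first by move: e0; rewrite ltcE => /andP[].
by rewrite /rc /cRe /= RRe_real ?gtr0_real.
Qed.

Lemma normCI : `|'i%C : C| = 1.
Proof. by rewrite normc_def /= expr0n expr1n add0r sqrtr1. Qed.

Lemma norm_cRe z : rc `|cRe z| <= `|z|.
Proof. exact: normc_ge_Re. Qed.

Lemma norm_cIm z : rc `|cIm z| <= `|z|.
Proof.
have := @normc_ge_Re R (z * 'i%C).
by rewrite ReiNIm normrN normrM normCI mulr1.
Qed.

Lemma ofplaneE q : ofplane q = rc q.1 + 'i%C * rc q.2 :> C.
Proof. by rewrite [LHS]complexE. Qed.

Lemma normC_rcr (x : R) : `|rc x| = rc `|x|.
Proof. by rewrite normc_def /= expr0n addr0 sqrtr_sqr. Qed.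

Lemma norm_ofplane q : `|ofplane q : C| <= rc (`|q.1| + `|q.2|).
Proof.
rewrite ofplaneE (le_trans (ler_normD _ _))// normrM normCI mul1r.
by rewrite !normC_rcr rcD.
Qed.

Lemma ofplaneB q q' : ofplane q - ofplane q' = ofplane (q - q') :> C.
Proof. by case: q q' => [a b] [a' b']. Qed.

(** Links the norm topology of [C] to the product topology of [R * R], on which measurable sets and
    area integrals are defined. *)
Lemma continuous_ofplane : continuous (@ofplane R : R * R -> C).
Proof.
move=> q; apply/cvgrPdist_lt => e /posC_rc[r r0 ->].
have r20 : 0 < r / 2 by rewrite divr_gt0.
near=> q'.
rewrite ofplaneB (le_lt_trans (norm_ofplane _))// ltr_rc [r in ltRHS]splitr ltrD//=.
- near: q'.
  have : (fun x : R * R => x.1) @ q --> q.1 by apply: cvg_fst.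
  by move/cvgrPdist_lt => /(_ _ r20).
- near: q'.
  have : (fun x : R * R => x.2) @ q --> q.2 by apply: cvg_snd.
  by move/cvgrPdist_lt => /(_ _ r20).
Unshelve. all: by end_near. Qed.

Lemma continuous_cRe : continuous (@cRe R : C -> R).
Proof.
move=> z; apply/(@cvgrPdist_lt _ _ _ (nbhs z)) => e e0.
have e0' : (0 : C) < rc e by rewrite -[ltLHS]/(rc 0) ltr_rc.
apply: (@filterS _ (nbhs z) _ _ _ _ (nbhsx_ballx z (rc e) e0')) => w zw.
rewrite -ltr_rc; apply: le_lt_trans zw.
by have := norm_cRe (z - w); case: (z) (w) => [a b] [a' b'].
Qed.

Lemma continuous_cIm : continuous (@cIm R : C -> R).
Proof.
move=> z; apply/(@cvgrPdist_lt _ _ _ (nbhs z)) => e e0.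
have e0' : (0 : C) < rc e by rewrite -[ltLHS]/(rc 0) ltr_rc.
apply: (@filterS _ (nbhs z) _ _ _ _ (nbhsx_ballx z (rc e) e0')) => w zw.
rewrite -ltr_rc; apply: le_lt_trans zw.
by have := norm_cIm (z - w); case: (z) (w) => [a b] [a' b'].
Qed.

Lemma cvg_ofplane (T : Type) (F : set_system T) {FF : Filter F}
    (f g : T -> R) (a b : R) :
  f @ F --> a -> g @ F --> b ->
  ofplane (f x, g x) @[x --> F] --> (ofplane (a, b) : C).
Proof.
move=> fa gb.
have : (f x, g x) @[x --> F] --> (a, b).
  by exact: (@cvg_pair _ _ _ F (nbhs a) (nbhs b) FF _ _ f g fa gb).
by move=> h; exact: (cvg_comp _ _ h (@continuous_ofplane (a, b))).
Qed.

Lemma normC_lt_nat z : exists n : nat, `|z| < n%:R.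
Proof.
have [r r0 ->] := normC_rc z.
exists (Num.bound r); rewrite -rc_nat ltr_rc.
by apply: le_lt_trans (archi_boundP r0).
Qed.

Lemma invn_ltC (e : C) : 0 < e -> exists n : nat, n.+1%:R^-1 < e.
Proof.
move=> /posC_rc[r r0 ->].
exists (Num.truncn r^-1).
have -> : (Num.truncn r^-1).+1%:R^-1 = rc ((Num.truncn r^-1).+1%:R^-1) :> C.
  by rewrite /rc /= fmorphV rmorph_nat.
rewrite ltr_rc invf_plt ?posrE//; exact: truncnS_gt.
Qed.

Lemma cvg_sumC (T I : Type) (F : set_system T) {FF : Filter F} (r : seq I)
    (f : I -> T -> C) (l : I -> C) :
  (forall i, f i @ F --> l i) ->
  \sum_(i <- r) f i x @[x --> F] --> \sum_(i <- r) l i.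
Proof.
move=> fl; elim: r => [|i r IH].
  rewrite big_nil; under eq_fun do rewrite big_nil; exact: cvg_cst.
rewrite big_cons; under eq_fun do rewrite big_cons.
exact: (cvgD (fl i) IH).
Qed.

End PlaneTopology.

(** * Planar integration *)

Section PlaneMeasure.
Set Implicit Arguments.
Unset Strict Implicit.
Variable R : realType.
Local Notation C := (Cx R).
Local Notation mu2 := (lebesgue_measure \x lebesgue_measure)%E.

(** An open set is the union of the open rectangles with rational corners that it contains, and
    these are countably many. *)
Lemma open_measurable_plane (A : set (R * R)) : open A -> measurable A.
Proof.
move=> oA.
pose rect (s : (rat * rat) * (rat * rat)) : set (R * R) :=
  `]ratr s.1.1, ratr s.1.2[%classic `*` `]ratr s.2.1, ratr s.2.2[%classic.
pose P s := `[< rect s `<=` A >].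
have -> : A = \bigcup_(s : (rat * rat) * (rat * rat)) (if P s then rect s else set0).
  apply/seteqP; split => [q Aq|q [s _]]; last first.
    by case: ifP => // /asboolP; exact.
  have [[U V] /= [Uq Vq] UVA] : nbhs q A by apply: open_nbhs_nbhs.
  have itv (x : R) (W : set R) : nbhs x W ->
      exists s : rat * rat, `]ratr s.1, ratr s.2[%classic x /\
        `]ratr s.1, ratr s.2[%classic `<=` W.
    move=> /nbhs_ballP[e /= e0 xeW].
    have [a] := @rat_in_itvoo R (x - e) x ltac:(by rewrite ltrBlDr ltrDl).
    have [b] := @rat_in_itvoo R x (x + e) ltac:(by rewrite ltrDl).
    rewrite !in_itv /= => /andP[xb be] /andP[ea ax].
    exists (a, b); split => /=; first by rewrite in_itv/= ax.
    move=> y /=; rewrite in_itv/= => /andP[ay yb]; apply: xeW.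
    by rewrite /ball /= ltr_distl; apply/andP; split; lra.
  have [s1 [s1q s1U]] := itv _ _ Uq.
  have [s2 [s2q s2V]] := itv _ _ Vq.
  exists (s1, s2) => //; have -> : P (s1, s2); last by [].
  apply/asboolP => -[x y] [/= xs ys]; apply: UVA.
  by split; [exact: s1U|exact: s2V].
apply: countable_bigcupT_measurable => // s.
case: ifP => // _; apply: measurableX; exact: measurable_itv.
Qed.

Definition cborel (D : set C) : Prop := measurable (@ofplane R @^-1` D).

Lemma cborel_open D : open D -> cborel D.
Proof.
move=> oD; apply: open_measurable_plane.
by apply: open_comp => // q _; exact: continuous_ofplane.
Qed.

Lemma cborelC D : cborel D -> cborel (~` D).
Proof. by move=> bD; rewrite /cborel preimage_setC; exact: measurableC. Qed.

Lemma cborelI D E : cborel D -> cborel E -> cborel (D `&` E).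
Proof. by move=> bD bE; rewrite /cborel preimage_setI; exact: measurableI. Qed.

Lemma cborelD D E : cborel D -> cborel E -> cborel (D `\` E).
Proof. by move=> bD bE; rewrite setDE; apply: cborelI => //; exact: cborelC. Qed.

Lemma cborel_bigcup (I : finType) (D : I -> set C) :
  (forall i, cborel (D i)) -> cborel (\bigcup_i D i).
Proof.
move=> bD; rewrite /cborel preimage_bigcup.
by apply: fin_bigcup_measurable => // i _; exact: bD.
Qed.

Lemma cborel_closed D : closed D -> cborel D.
Proof.
move=> cD; rewrite -(setCK D); apply: cborelC; apply: cborel_open.
exact: closed_openC.
Qed.


Lemma reRM (F G : C -> C) q :
  reR (fun z => F z * G z) q = reR F q * reR G q - imR F q * imR G q.
Proof. by rewrite /reR /imR; case: (F _) (G _) => [a b] [a' b']. Qed.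

Lemma imRM (F G : C -> C) q :
  imR (fun z => F z * G z) q = reR F q * imR G q + imR F q * reR G q.
Proof. by rewrite /reR /imR; case: (F _) (G _) => [a b] [a' b']. Qed.

Lemma cmeasurableM D (F G : C -> C) : cmeasurable D F -> cmeasurable D G ->
  cmeasurable D (fun z => F z * G z).
Proof.
move=> [rF iF] [rG iG]; split.
  rewrite (_ : reR _ = (reR F \* reR G \- imR F \* imR G)); last first.
    by apply/funext => q; rewrite reRM.
  by apply: measurable_funB; apply: measurable_funM.
rewrite (_ : imR _ = (reR F \* imR G \+ imR F \* reR G)); last first.
  by apply/funext => q; rewrite imRM.
by apply: measurable_funD; apply: measurable_funM.
Qed.

Lemma cmeasurable_sub D E (F : C -> C) : E `<=` D -> cborel D ->
  cmeasurable D F -> cmeasurable E F.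
Proof.
by move=> ED bD [rF iF]; split; (apply: measurable_funS; [exact: bD| |]) => // q /ED.
Qed.

Lemma cmeasurable_cst D (x : C) : cmeasurable D (fun=> x).
Proof. by split; exact: measurable_cst. Qed.

Lemma cmeasurable_continuous D (F : C -> C) : cborel D ->
  (forall z, D z -> {for z, continuous F}) -> cmeasurable D F.
Proof.
move=> bD cF.
have cR (g : C -> R) : continuous g ->
    measurable_fun (@ofplane R @^-1` D) (fun q => g (F (ofplane q))).
  move=> cg; refine (measurability _ (RGenOpens.measurableE R) _).
  move=> _ [_ [a [b ->] <-]].
  set V : set R := `]a, b[%classic.
  have oV : open V by exact: interval_open.
  (* [D] need not be open. Continuity of [F] at the points of [D] places those sent into [V] in the
     interior of the preimage, so on [D] the preimage may be replaced by an open set. *)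
  suff -> : (@ofplane R @^-1` D `&` (fun q => g (F (ofplane q))) @^-1` V) =
      @ofplane R @^-1` (D `&` interior ((g \o F) @^-1` V)).
    by apply: cborelI => //; apply: cborel_open; exact: open_interior.
  apply/seteqP; split => q /= [Dq Vq]; split => //.
    have cgF : {for ofplane q, continuous (g \o F)}.
      by apply: continuous_comp; [exact: cF|exact: cg].
    by apply: cgF; apply: open_nbhs_nbhs.
  exact: (nbhs_singleton Vq).
by split; apply: cR; [exact: continuous_cRe|exact: continuous_cIm].
Qed.

Lemma cmeasurable_patch D E (F : C -> C) : cborel D -> D `<=` E -> cborel E ->
  cmeasurable D F -> cmeasurable E (fun z => if `[< D z >] then F z else 0).
Proof.
move=> bD DE bE [rF iF].
have patch (g : R * R -> R) : measurable_fun (@ofplane R @^-1` D) g ->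
    measurable_fun (@ofplane R @^-1` E) (g \_ (@ofplane R @^-1` D)).
  move=> mg; refine (proj1 (measurable_restrict g bD bE) _).
  by rewrite (_ : _ `&` _ = @ofplane R @^-1` D)//; apply/setIidPr => q /DE.
split.
  apply: eq_measurable_fun (patch _ rF) => q _ /=.
  rewrite /restrict /reR /patch; case: asboolP => Dq; first by rewrite mem_set.
  by rewrite memNset.
apply: eq_measurable_fun (patch _ iF) => q _ /=.
rewrite /restrict /imR /patch; case: asboolP => Dq; first by rewrite mem_set.
by rewrite memNset.
Qed.

(* [area_int] integrates over [measurableTypeR R], whose measurable sets are
   convertible to, but not syntactically, those of the instance on [R]. *)
Local Notation RR := (measurableTypeR R * measurableTypeR R)%type.

Lemma cborel_RR D : cborel D -> @measurable _ RR (@ofplane R @^-1` D).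
Proof. by []. Qed.

Lemma cmeasurable_RR D F : cmeasurable D F ->
  @measurable_fun _ _ RR R (@ofplane R @^-1` D) (reR F) /\
  @measurable_fun _ _ RR R (@ofplane R @^-1` D) (imR F).
Proof. by []. Qed.

Definition cint (D : set C) (F : C -> C) : Prop :=
  mu2.-integrable (@ofplane R @^-1` D) (EFin \o reR F) /\
  mu2.-integrable (@ofplane R @^-1` D) (EFin \o imR F).

Lemma area_int_lin D (F G : C -> C) (x : C) : cborel D -> cint D F -> cint D G ->
  cint D (fun z => x * F z + G z) /\
  area_int D (fun z => x * F z + G z) = x * area_int D F + area_int D G.
Proof.
move=> /cborel_RR bD [rF iF] [rG iG].
(* The real and the imaginary part of [x * F + G] are both real combinations of this shape. *)
have lin (f g h : R * R -> R) (a b : R) :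
    mu2.-integrable (@ofplane R @^-1` D) (EFin \o f) ->
    mu2.-integrable (@ofplane R @^-1` D) (EFin \o g) ->
    mu2.-integrable (@ofplane R @^-1` D) (EFin \o h) ->
    mu2.-integrable (@ofplane R @^-1` D) (EFin \o (fun q => a * f q + (b * g q + h q))) /\
    Rintegral mu2 (@ofplane R @^-1` D) (fun q => a * f q + (b * g q + h q)) =
    a * Rintegral mu2 (@ofplane R @^-1` D) f +
    (b * Rintegral mu2 (@ofplane R @^-1` D) g + Rintegral mu2 (@ofplane R @^-1` D) h).
  move=> If Ig Ih.
  have Iaf : mu2.-integrable (@ofplane R @^-1` D) (EFin \o (fun q => a * f q)).
    exact: (integrableZl bD a If).
  have Ibg : mu2.-integrable (@ofplane R @^-1` D) (EFin \o (fun q => b * g q)).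
    exact: (integrableZl bD b Ig).
  have Ibgh : mu2.-integrable (@ofplane R @^-1` D) (EFin \o (fun q => b * g q + h q)).
    exact: (integrableD bD Ibg Ih).
  split; first exact: (integrableD bD Iaf Ibgh).
  by rewrite RintegralD// RintegralD// !RintegralZl.
have rE : reR (fun z => x * F z + G z) =
    (fun q => cRe x * reR F q + (- cIm x * imR F q + reR G q)).
  apply/funext => q; rewrite /reR /imR; case: (x) (F _) (G _) => [a b] [a' b'] [a'' b''] /=.
  by rewrite mulNr addrA.
have iE : imR (fun z => x * F z + G z) =
    (fun q => cRe x * imR F q + (cIm x * reR F q + imR G q)).
  apply/funext => q; rewrite /reR /imR; case: (x) (F _) (G _) => [a b] [a' b'] [a'' b''] /=.
  by rewrite addrA.
have [I1 E1] := lin _ _ _ (cRe x) (- cIm x) rF iF rG.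
have [I2 E2] := lin _ _ _ (cRe x) (cIm x) iF rF iG.
split; first by split; rewrite ?rE ?iE.
rewrite /area_int rE iE E1 E2 /ofplane /=; case: (x) => a b /=.
by apply/eqP; rewrite eq_complex /= mulNr addrA eqxx /= addrA.
Qed.

Lemma area_int0 D : cint D (fun=> 0) /\ area_int D (fun=> 0) = 0.
Proof.
split; first by split; exact: integrable0.
rewrite [RHS](_ : _ = ofplane (0, 0) :> C)//; congr (ofplane (_, _)).
  by rewrite /Rintegral integral0_eq.
by rewrite /Rintegral integral0_eq.
Qed.

Lemma area_int_sum D (I : finType) (c : I -> C) (F : I -> C -> C) : cborel D ->
  (forall a, cint D (F a)) ->
  area_int D (fun z => \sum_a c a * F a z) = \sum_a c a * area_int D (F a).
Proof.
move=> bD iF.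
suff H (r : seq I) : cint D (fun z => \sum_(a <- r) c a * F a z) /\
    area_int D (fun z => \sum_(a <- r) c a * F a z) =
    \sum_(a <- r) c a * area_int D (F a) by case: (H (index_enum I)).
elim: r => [|a r [IH1 IH2]].
  under eq_fun do rewrite big_nil; rewrite big_nil; exact: area_int0.
under eq_fun do rewrite big_cons; rewrite big_cons -IH2.
exact: area_int_lin.
Qed.

Lemma eq_area_int D (F G : C -> C) : (forall z, D z -> F z = G z) ->
  area_int D F = area_int D G.
Proof.
move=> FG; rewrite /area_int; congr (ofplane (_, _)); apply: eq_Rintegral => q /set_mem Dq.
  by rewrite /reR FG.
by rewrite /imR FG.
Qed.

(** Both sides integrate, over the whole plane, the same extension by zero. *)
Lemma area_int_patch D E (F G : C -> C) :
  (forall z, D z -> E z -> F z = G z) ->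
  (forall z, D z -> ~ E z -> F z = 0) ->
  (forall z, ~ D z -> E z -> G z = 0) ->
  area_int D F = area_int E G.
Proof.
move=> FG F0 G0; have H z : (if `[< D z >] then F z else 0) = (if `[< E z >] then G z else 0).
  by case: asboolP => Dz; case: asboolP => Ez //; [exact: FG|exact: F0|rewrite G0].
have memE (A : set C) q : (q \in @ofplane R @^-1` A) = `[< A (ofplane q) >].
  by apply/idP/asboolP; rewrite inE.
rewrite /area_int; congr (ofplane (_, _)).
  rewrite Rintegral_mkcond [RHS]Rintegral_mkcond; congr Rintegral.
  apply/funext => q; rewrite /patch !memE.
  by have := congr1 (@cRe R) (H (ofplane q)); do 2 case: ifP.
rewrite Rintegral_mkcond [RHS]Rintegral_mkcond; congr Rintegral.
apply/funext => q; rewrite /patch !memE.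
by have := congr1 (@cIm R) (H (ofplane q)); do 2 case: ifP.
Qed.


Lemma fin_disc (D : set C) (M : C) : cborel D -> (forall z, D z -> `|z| <= M) ->
  (mu2 (@ofplane R @^-1` D) < +oo)%E.
Proof.
move=> /cborel_RR bD DM; set r := cRe M.
have mI : @measurable _ (measurableTypeR R) `[- r, r]%classic by exact: measurable_itv.
apply: (@le_lt_trans _ _ (mu2 (`[- r, r]%classic `*` `[- r, r]%classic))).
  apply: le_measure; rewrite ?inE //; first exact: measurableX.
  move=> q /= /DM qM.
  have H x : rc `|x| <= `|ofplane q : C| -> - r <= x <= r.
    by move=> /le_trans/(_ qM); rewrite lecE => /andP[_]; rewrite ler_norml.
  split; rewrite /= in_itv /=; apply: H.
    exact: (norm_cRe (ofplane q)).
  exact: (norm_cIm (ofplane q)).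
rewrite product_measure1E// [X in (X * _)%E](_ : _ = lebesgue_measure `[- r, r]%classic)//.
rewrite [X in (_ * X)%E](_ : _ = lebesgue_measure `[- r, r]%classic)//.
rewrite !lebesgue_measure_itv/=.
by case: ifPn => _; rewrite -?EFinD -?EFinM ?mul0e ltry.
Qed.

Lemma cint_bounded D (F : C -> C) (M B : C) : cborel D ->
  (forall z, D z -> `|z| <= M) -> cmeasurable D F ->
  (forall z, D z -> `|F z| <= B) -> cint D F.
Proof.
move=> bD DM /cmeasurable_RR[rF iF] FB.
have fD := fin_disc bD DM.
have bnd (g : R * R -> R) : (forall q, rc `|g q| <= `|F (ofplane q)|) ->
    [bounded g q | q in @ofplane R @^-1` D].
  move=> gF; exists (cRe B); split; first exact: num_real.
  move=> x Bx q /= Dq; apply: le_trans (ltW Bx).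
  by have := le_trans (gF q) (FB _ Dq); rewrite lecE => /andP[].
split; apply: measurable_bounded_integrable => //; apply: bnd => q.
  exact: norm_cRe.
exact: norm_cIm.
Qed.

(** Bounded convergence: [D] lies in a square of finite area, so the constant [B] dominates. The
    exceptional null set [N] accommodates the boundary circle of the moving half node pieces. *)
Lemma area_int_dct D (Fn : nat -> C -> C) (F : C -> C) (N : set (R * R)) (M B : C) :
  cborel D -> (forall z, D z -> `|z| <= M) ->
  (forall n, cmeasurable D (Fn n)) -> cmeasurable D F ->
  mu2.-negligible N ->
  (forall z, D z -> ~ N (toplane z) -> Fn ^~ z @ \oo --> F z) ->
  (forall n z, D z -> `|Fn n z| <= B) ->
  area_int D (Fn n) @[n --> \oo] --> area_int D F.
Proof.
move=> /[dup] bD /cborel_RR mD DM mFn mF N0 FnF FnB.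
have fD := fin_disc bD DM.
have H (g : nat -> R * R -> R) (h : R * R -> R) :
    (forall n, @measurable_fun _ _ RR R (@ofplane R @^-1` D) (g n)) ->
    @measurable_fun _ _ RR R (@ofplane R @^-1` D) h ->
    (forall q, D (ofplane q) -> ~ N q -> g ^~ q @ \oo --> h q) ->
    (forall n q, rc `|g n q| <= `|Fn n (ofplane q)|) ->
    Rintegral mu2 (@ofplane R @^-1` D) (g n) @[n --> \oo] -->
    Rintegral mu2 (@ofplane R @^-1` D) h.
  move=> mg mh gh gF; rewrite /Rintegral.
  have Ib : mu2.-integrable (@ofplane R @^-1` D) (cst (cRe B)%:E).
    apply: (measurable_bounded_integrable (f := cst (cRe B)) mD fD) => //.
    exists `|cRe B|; split; first exact: num_real.
    by move=> x Bx q _ /=; exact: ltW.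
  have [] := @dominated_convergence _ _ _ mu2 _ mD (fun n => EFin \o g n) (EFin \o h)
      (cst (cRe B)%:E) _ _ _ Ib _.
  - by move=> n; apply/measurable_EFinP; exact: mg.
  - by apply/measurable_EFinP.
  - case: N0 => A [mA A0 NA]; exists A; split => // q /= nq; apply: NA.
    apply: contrapT => nN; apply: nq => Dq.
    by apply: cvg_EFin; [exact: nearW|exact: gh].
  - apply: aeW => q n Dq; rewrite lee_fin.
    by have := le_trans (gF n q) (FnB n _ Dq); rewrite lecE => /andP[].
  move=> Ih _ cvgI; apply: fine_cvg; apply: cvg_trans cvgI _; rewrite fineK//.
  exact: integrable_fin_num.
rewrite /area_int; apply: cvg_ofplane; apply: H.
- by move=> n; case/cmeasurable_RR: (mFn n).
- by case/cmeasurable_RR: mF.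
- move=> q Dq Nq; have := FnF _ Dq; rewrite ofplaneK => /(_ Nq) h.
  exact: (cvg_comp _ _ h (@continuous_cRe R (F (ofplane q)))).
- by move=> n q; exact: norm_cRe.
- by move=> n; case/cmeasurable_RR: (mFn n).
- by case/cmeasurable_RR: mF.
- move=> q Dq Nq; have := FnF _ Dq; rewrite ofplaneK => /(_ Nq) h.
  exact: (cvg_comp _ _ h (@continuous_cIm R (F (ofplane q)))).
- by move=> n q; exact: norm_cIm.
Qed.

Lemma continuous_sqrnorm : continuous (fun z : C => `|z| ^+ 2).
Proof.
move=> z; have nz : `|w| @[w --> z] --> `|z| by exact: (@norm_continuous _ (C)).
rewrite (_ : (fun w : C => _) = (fun w => `|w| * `|w|)); last by apply/funext => w; rewrite expr2.
exact: (cvgM nz nz).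
Qed.

(** A vertical line meets the circle in a subset of some {y, -y}, a null set; the area integrates
    these section lengths. *)
Lemma circle_negligible (r : C) :
  mu2.-negligible [set q | `|ofplane q : C| ^+ 2 = r].
Proof.
set A := (X in _.-negligible X).
have clA : closed [set z : C | `|z| ^+ 2 = r].
  have hC : hausdorff_space C by exact: norm_hausdorff.
  apply: (@closed_comp C C (fun z : C => `|z| ^+ 2) [set r]).
    by move=> z _; exact: continuous_sqrnorm.
  apply: accessible_closed_set1; exact: hausdorff_accessible.
have mA : @measurable _ RR A by exact: (cborel_RR (cborel_closed clA)).
exists A; split => //.
rewrite /product_measure1 /=; apply: integral0_eq => x _ /=.
have [y Hy] : exists y : R, xsection A x `<=` [set y] `|` [set - y].
  exists (Num.sqrt (cRe r - x ^+ 2)) => y; rewrite /xsection /= inE /A /=.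
  rewrite -add_Re2_Im2 /= => <- /=; rewrite addrAC subrr add0r sqrtr_sqr.
  by case: (ger0P y) => _; [left|right; rewrite opprK].
apply/eqP; rewrite eq_le measure_ge0 andbT.
apply: (@le_trans _ _ (lebesgue_measure ([set y] `|` [set - y]))).
  apply: le_measure; rewrite ?inE //; first exact: measurable_xsection.
  by apply: measurableU; exact: measurable_set1.
have L (u : measurableTypeR R) : lebesgue_measure [set u] = 0%E.
  exact: (lebesgue_measure_set1 u).
rewrite measureU0//; try exact: measurable_set1.
exact: (eq_ind_r (fun t => (t <= 0)%E) (lexx _) (L y)).
exact: L.
Qed.

End PlaneMeasure.

(** * Diagonal sums *)

Section LaurUnique.
Set Implicit Arguments.
Unset Strict Implicit.

(** ['X^n - 1] splits over a closed field and is separable in characteristic zero, so it has n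
    distinct roots; a field with n distinct n-th roots of unity has a primitive one. *)
Lemma closed_prim_root (K : numClosedFieldType) (n : nat) : (0 < n)%N ->
  exists w : K, n.-primitive_root w.
Proof.
move=> n_gt0; pose p : {poly K} := 'X^n - 1.
have [r Dp] := closed_field_poly_normal p.
move: Dp; rewrite (monicP _); last by rewrite /p monicXnsubC.
rewrite scale1r => Dp.
have rn1 : all n.-unity_root r.
  by apply/allP => z; rewrite unity_rootE -subr_eq0 -root_prod_XsubC -Dp rootE !hornerE ?hornerXn.
have sz_r : (n < (size r).+1)%N by rewrite -(size_prod_XsubC r id) -Dp size_XnsubC.
have [|z] := hasP (has_prim_root n_gt0 rn1 _ sz_r); last by exists z.
rewrite -separable_prod_XsubC -Dp separable_Xn_sub_1 //.
by rewrite pnatr_eq0 -lt0n.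
Qed.

Variable R : realType.
Local Notation C := (Cx R).

(** Otherwise [T] would climb by more than [eps] again and again and overtake [M]. Values can be
    compared because their differences are nonnegative, hence real. *)
Lemma cauchy_of_bounded (T : nat -> C) (M eps : C) :
  {homo T : x y / (x <= y)%N >-> x <= y} -> 0 <= T 0 -> (forall n, T n <= M) -> 0 < eps ->
  exists N0, forall N, (N0 <= N)%N -> T N - T N0 <= eps.
Proof.
move=> mT T0 TM e0; apply: contrapT => H.
have step N0 : exists2 N, (N0 <= N)%N & eps < T N - T N0.
  apply: contrapT => nN; apply: H; exists N0 => N N0N.
  have d0 : 0 <= T N - T N0 by rewrite subr_ge0 mT.
  case: (real_leP (ger0_real d0) (gtr0_real e0)) => // lt.
  by exfalso; apply: nN; exists N.
have grow k : exists N, k%:R * eps <= T N.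
  elim: k => [|k [N IH]]; first by exists 0%N; rewrite mul0r.
  have [N' _ lt] := step N; exists N'.
  by rewrite -natr1 mulrDl mul1r -(subrK (T N) (T N')) addrC lerD// ltW.
have [k Mk] := normC_lt_nat (M / eps).
have [N kN] := grow k.
have M0 : 0 <= M by apply: le_trans T0 (TM _).
move: Mk; rewrite ger0_norm ?divr_ge0 ?(ltW e0)// ltr_pdivrMr// => Mk.
by have := lt_le_trans Mk (le_trans kN (TM N)); rewrite ltxx.
Qed.

(* Averaging over the K-th roots of unity u kills the terms with p <> q and
   |p - q| < K, and the others are in the tail of an absolutely bounded sum. *)
Lemma diag_eq0 (b : nat -> nat -> C) (l : C) :
  (exists M, forall N, \sum_(p < N) \sum_(q < N) `|b p q| <= M) ->
  (forall u : C, `|u| = 1 ->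
     (fun N => \sum_(p < N) \sum_(q < N) b p q * (u ^+ p * u ^- q)) @ \oo --> (0 : C)) ->
  (fun N => \sum_(p < N) b p p) @ \oo --> l -> l = 0.
Proof.
move=> [M TM] S0 Dl; apply/eqP; rewrite -normr_eq0; apply/eqP.
apply: le_anti; rewrite normr_ge0 andbT.
have [//|l0] := real_leP (normr_real l) (real0 C); exfalso.
(* The error terms will add up to [eps / 2 + eps], less than [|l| = eps + eps]. *)
pose eps := `|l| / 2; have e0 : 0 < eps by rewrite divr_gt0.
pose T N : C := \sum_(p < N) \sum_(q < N) `|b p q|.
(* Written over the larger square, [T N - T N0] is visibly the sum over the indices outside the [N0]
   square. *)
have TE N0 N : (N0 <= N)%N ->
    T N0 = \sum_(p < N) \sum_(q < N) (if (p < N0)%N && (q < N0)%N then `|b p q| else 0).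
  move=> le; rewrite /T.
  rewrite (big_ord_widen _ (fun p => \sum_(q < N0) `|b p q|) le) big_mkcond.
  apply: eq_bigr => p _; case: ifP => pN /=; last by rewrite big1.
  by rewrite (big_ord_widen _ (fun q => `|b p q|) le) big_mkcond.
have mT : {homo T : x y / (x <= y)%N >-> x <= y}.
  move=> N0 N le; rewrite (TE _ _ le) /T.
  by apply: ler_sum => p _; apply: ler_sum => q _; case: ifP.
have T0 : 0 <= T 0%N by rewrite /T big_ord0.
have [N0 HN0] := cauchy_of_bounded mT T0 TM e0.
(* Indices below [N0] are distinct modulo [K], so the average kills every off-diagonal term of the
   [N0] square; the successor keeps [K] positive. *)
pose K := N0.+1.
have K0 : (0 : C) < K%:R by rewrite ltr0n.
have [w pw] := @closed_prim_root C K isT.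
have w1 : `|w| = 1.
  apply/eqP; rewrite -(@pexpr_eq1 _ _ K)//= -normrX (prim_expr_order pw).
  by rewrite normr1.
have w_neq0 : w != 0 by rewrite -normr_eq0 w1 oner_eq0.
pose g p q : C := \sum_(j < K) (w ^+ j) ^+ p * (w ^+ j) ^- q.
have gpp p : g p p = K%:R.
  rewrite /g (eq_bigr (fun=> 1)) ?sumr_const ?card_ord// => j _.
  by rewrite divff// !expf_neq0.
have gle p q : `|g p q| <= K%:R.
  apply: le_trans (ler_norm_sum _ _ _) _.
  rewrite (eq_bigr (fun=> 1)) ?sumr_const ?card_ord// => j _.
  by rewrite normrM normfV !normrX w1 !expr1n invr1 mulr1.
have g0 p q : (p < K)%N -> (q < K)%N -> p != q -> g p q = 0.
  move=> pK qK pq; set v := w ^+ p / w ^+ q.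
  have -> : g p q = \sum_(j < K) v ^+ j.
    apply: eq_bigr => j _; rewrite /v exprMn exprVn -!exprM.
    by rewrite (mulnC p) (mulnC q) !exprM.
  have v1 : v != 1.
    rewrite /v; apply/eqP => /divr1_eq /eqP.
    by rewrite (eq_prim_root_expr pw) /eqn !modn_small// (negbTE pq).
  (* Geometric sum: multiplied by v - 1 it becomes v^K - 1, which is 0 since w^K = 1. *)
  apply/eqP; rewrite -(mulrI_eq0 _ (mulfI (_ : v - 1 != 0))) ?subr_eq0//.
  rewrite -subrX1 /v exprMn exprVn -!exprM -![(_ * K)%N]mulnC !exprM.
  by rewrite (prim_expr_order pw) !expr1n divr1 subrr.
pose S u N : C := \sum_(p < N) \sum_(q < N) b p q * (u ^+ p * u ^- q).
pose D N : C := \sum_(p < N) b p p.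
(* In this difference [b p q] has weight K - g on the diagonal and -g off it. The weight vanishes
   inside the [N0] square and on the diagonal and has norm at most K elsewhere, so only the tail
   [T N - T N0] contributes. *)
have key N : (N0 <= N)%N -> `|K%:R * D N - \sum_(j < K) S (w ^+ j) N| <= K%:R * eps.
  move=> le.
  have -> : K%:R * D N - \sum_(j < K) S (w ^+ j) N =
      \sum_(p < N) \sum_(q < N) b p q * ((if p == q :> nat then K%:R else 0) - g p q).
    have -> : \sum_(j < K) S (w ^+ j) N = \sum_(p < N) \sum_(q < N) b p q * g p q.
      rewrite exchange_big; apply: eq_bigr => p _ /=.
      rewrite exchange_big; apply: eq_bigr => q _ /=.
      by rewrite /g mulr_sumr.
    have -> : K%:R * D N = \sum_(p < N) \sum_(q < N) b p q * (if p == q :> nat then K%:R else 0).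
      rewrite mulr_sumr; apply: eq_bigr => p _.
      rewrite (bigD1 p)//= eqxx mulrC big1 ?addr0// => q qp.
      by rewrite eq_sym (negbTE qp : (q == p :> nat) = false) mulr0.
    rewrite -sumrB; apply: eq_bigr => p _; rewrite -sumrB; apply: eq_bigr => q _.
    by rewrite mulrBr.
  apply: (@le_trans _ _ (K%:R * (T N - T N0))); last by rewrite ler_pM2l// HN0.
  rewrite (TE _ _ le) /T -sumrB mulr_sumr.
  apply: le_trans (ler_norm_sum _ _ _) _; apply: ler_sum => p _.
  rewrite -sumrB mulr_sumr.
  apply: le_trans (ler_norm_sum _ _ _) _; apply: ler_sum => q _.
  rewrite normrM; case: (boolP ((p < N0)%N && (q < N0)%N)) => [/andP[pN qN]|_].
    rewrite subrr mulr0; case: eqP => [->|/eqP pq]; first by rewrite gpp subrr normr0 mulr0.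
    by rewrite g0 ?subr0 ?normr0 ?mulr0// ltnS ltnW.
  rewrite subr0 mulrC; apply: ler_wpM2r => //.
  case: eqP => [->|_]; first by rewrite gpp subrr normr0.
  by rewrite sub0r normrN.
have lim : (fun N => K%:R * D N - \sum_(j < K) S (w ^+ j) N) @ \oo --> K%:R * l - 0.
  apply: cvgB; first by apply: cvgMl_tmp.
  rewrite [X in _ --> X](_ : _ = \sum_(j < K) (0 : C)); last by rewrite big1.
  by apply: cvg_sumC => j; apply: S0; rewrite normrX w1 expr1n.
move/cvgrPdist_le: lim => /(_ (K%:R * (eps / 2))).
rewrite mulr_gt0 ?divr_gt0// => /(_ isT) [N1 _ HN1].
have /= A1 := HN1 (maxn N0 N1) (leq_maxr _ _).
have A2 := key (maxn N0 N1) (leq_maxl _ _).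
have : `|K%:R * l| <= K%:R * (eps / 2) + K%:R * eps.
  set A := K%:R * D (maxn N0 N1) - \sum_(j < K) S (w ^+ j) (maxn N0 N1) in A1 A2.
  rewrite -[K%:R * l]subr0 -(subrK A (K%:R * l - 0)).
  by apply: le_trans (ler_normD _ _) _; apply: lerD.
rewrite normrM ger0_norm ?(ltW K0)// -mulrDr ler_pM2l// => H.
have : eps + eps <= eps / 2 + eps by rewrite {1 2}/eps -splitr.
rewrite lerD2r ler_pdivlMr// mulr_natr mulr2n gerDl => /le_lt_trans/(_ e0).
by rewrite ltxx.
Qed.

End LaurUnique.

(** * Laurent coefficients *)

Section Laur.
Set Implicit Arguments.
Unset Strict Implicit.
Variables (R : realType) (X : surface R) (n m : nat) (d : st_data X n m).
Local Notation C := (Cx R).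
Local Notation base := ('rV[C]_n * 'rV[C]_m)%type.
Local Notation c := (rc (Defs.cst d)).
Local Notation ix := ('I_n + 'I_m)%type.

Lemma eq_Laur k psi chi (b : base) : qd_eq_at d b psi chi ->
  Laur d k psi b = Laur d k chi b.
Proof.
move=> [_ eqn].
have E a : node_expansion d k psi b a <-> node_expansion d k chi b a.
  split=> H z w zw; have [H1 H2] := H z w zw; split; first exact: H1.
    by rewrite -(eqn _ _ _ zw); exact: H2.
  exact: H1.
  by rewrite (eqn _ _ _ zw); exact: H2.
have S : is_laur d k psi b = is_laur d k chi b.
  apply/funext => l; apply/propext; split=> -[a Ha Hl].
    exact: (ex_intro2 _ _ a ((E a).1 Ha) Hl).
  exact: (ex_intro2 _ _ a ((E a).2 Ha) Hl).
by rewrite /Laur S.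
Qed.

(** Linearity is proved for the relation: [Laur] selects a value by choice, and is linear only where
    that value is unique. The expansions are combined with the coefficients [f a b], constant on the
    fiber. *)
Lemma is_laur_qcomb k (F : ix -> qd X n m) (f : ix -> base -> C) (b : base) (l : ix -> C) :
  (forall a, is_laur d k (F a) b (l a)) ->
  is_laur d k (qcomb f F) b (\sum_a f a b * l a).
Proof.
move=> HF; have ex2E (T : Type) (P Q : T -> Prop) : (exists2 x, P x & Q x) -> exists x, P x /\ Q x.
  by case=> x; exists x.
have [A HA] := choice (fun a => ex2E _ _ _ (HF a)).
exists (fun p q => \sum_a f a b * A a p q).
  move=> z w zw; split.
    have [M HM] := choice (fun a => proj1 ((HA a).1 z w zw)).
    exists (\sum_a `|f a b| * M a) => N.
    apply: (@le_trans _ _ (\sum_(p < N) \sum_(q < N) \sum_a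
        `|f a b| * `|A a p q * z ^+ p * w ^+ q|)).
      apply: ler_sum => p _; apply: ler_sum => q _.
      rewrite !mulr_suml; apply: le_trans (ler_norm_sum _ _ _) _.
      by apply: ler_sum => a _; rewrite -!mulrA normrM.
    under eq_bigr do rewrite exchange_big /=.
    rewrite exchange_big /=; apply: ler_sum => a _.
    under eq_bigr do rewrite -mulr_sumr.
    by rewrite -mulr_sumr; apply: ler_wpM2l; [exact: normr_ge0|exact: HM].
  rewrite /= (_ : (fun N => _) = (fun N => \sum_a
      f a b * \sum_(p < N) \sum_(q < N) A a p q * z ^+ p * w ^+ q)).
    apply: cvg_sumC => a; apply: cvgMl_tmp; exact: (proj2 ((HA a).1 z w zw)).
  apply/funext => N.
  rewrite (eq_bigr (fun p : 'I_N => \sum_a f a b * \sum_(q < N) A a p q * z ^+ p * w ^+ q)).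
    by rewrite exchange_big /=; apply: eq_bigr => a _; rewrite mulr_sumr.
  move=> p _; under [RHS]eq_bigr do rewrite mulr_sumr.
  rewrite exchange_big /=; apply: eq_bigr => q _.
  by rewrite !mulr_suml; apply: eq_bigr => a _; rewrite !mulrA.
rewrite (_ : (fun N => _) = (fun N => \sum_a f a b * (4 * \sum_(p < N) A a p p * tk k b ^+ p))).
  by apply: cvg_sumC => a; apply: cvgMl_tmp; exact: (HA a).2.
apply/funext => N; under eq_bigr do rewrite mulr_suml.
rewrite exchange_big /= mulr_sumr; apply: eq_bigr => a _.
rewrite mulrCA; congr (_ * _); rewrite mulr_sumr; apply: eq_bigr => p _.
by rewrite mulrA.
Qed.

Hypothesis c01 : 0 < Defs.cst d < 1.
Hypothesis radc : Defs.rad d <= Defs.cst d ^+ 4.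

Lemma cst_gt0 : (0 : C) < c.
Proof. by case/andP: c01 => c0 _; rewrite -[ltLHS]/(rc 0) ltr_rc. Qed.

Lemma cst2_lt : c ^+ 2 < c.
Proof.
rewrite expr2 -rcM ltr_rc; case/andP: c01 => c0 c1.
by rewrite gtr_pMr.
Qed.

(** Two expansions have the same sum at (z0 u, w0 / u) for all u on the unit circle, and their
    diagonal terms there do not depend on u because z0 w0 = t. [diag_eq0] applied to the difference
    gives l - l' = 0. *)
Lemma is_laur_unique k psi (b : base) l l' : `|tk k b| < rc (Defs.rad d) ->
  is_laur d k psi b l -> is_laur d k psi b l' -> l = l'.
Proof.
move=> tb [a Ha al] [a' Ha' al']; set t := tk k b in tb al al'.
(* With |z0| = c^2 < c and |t| < c^4 one has |w0| < c^2 < c, so the whole rotated circle lies in the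
   node piece. If t = 0, then w0 = 0 and the argument is unchanged. *)
pose z0 : C := c ^+ 2; pose w0 := t / z0.
have c0 := cst_gt0; have z00 : 0 < z0 by rewrite exprn_gt0.
have z0n : z0 != 0 by rewrite gt_eqF.
have nd (u : C) : `|u| = 1 -> in_node d k b (z0 * u) (w0 / u).
  move=> u1; have u0 : u != 0 by rewrite -normr_eq0 u1 oner_eq0.
  split.
  - by rewrite normrM u1 mulr1 gtr0_norm// cst2_lt.
  - rewrite normrM normfV u1 invr1 mulr1 /w0 normrM normfV (gtr0_norm z00).
    rewrite ltr_pdivrMr//; apply: (lt_trans tb).
    apply: (@le_lt_trans _ _ (c ^+ 2 * z0)).
      by rewrite /z0 -exprD /rc -rmorphXn lecR.
    by rewrite ltr_pM2r// cst2_lt.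
  - by rewrite mulrACA divff// mulr1 /w0 mulrC divfK.
apply/eqP; rewrite -subr_eq0; apply/eqP.
have Sl : (fun N => \sum_(p < N) 4 * ((a p p - a' p p) * z0 ^+ p * w0 ^+ p)) @ \oo --> l - l'.
  rewrite (_ : (fun N => _) = (fun N =>
      4 * \sum_(p < N) a p p * t ^+ p - 4 * \sum_(p < N) a' p p * t ^+ p)).
    exact: (cvgB al al').
  apply/funext => N; rewrite -mulrBr -sumrB mulr_sumr; apply: eq_bigr => p _.
  by rewrite -mulrA -exprMn /w0 [z0 * _]mulrC divfK// mulrBl.
apply: (diag_eq0 (b := fun p q => 4 * ((a p q - a' p q) * z0 ^+ p * w0 ^+ q))) Sl.
  have := nd 1 (normr1 _); rewrite invr1 !mulr1 => n1.
  have [[M HM] _] := Ha _ _ n1; have [[M' HM'] _] := Ha' _ _ n1.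
  exists (4 * (M + M')) => N.
  apply: (@le_trans _ _ (4 * (\sum_(p < N) \sum_(q < N) `|a p q * z0 ^+ p * w0 ^+ q| +
     \sum_(p < N) \sum_(q < N) `|a' p q * z0 ^+ p * w0 ^+ q|))).
    rewrite -big_split /= mulr_sumr; apply: ler_sum => p _.
    rewrite -big_split /= mulr_sumr; apply: ler_sum => q _.
    rewrite normrM normr_nat ler_wpM2l// !mulrBl; exact: ler_normB.
  by rewrite ler_wpM2l// lerD.
move=> u u1; have [_ Hu] := Ha _ _ (nd u u1); have [_ Hu'] := Ha' _ _ (nd u u1).
have := cvgMl_tmp (a := (4 : C)) (cvgB Hu Hu').
rewrite subrr mulr0 => HG.
rewrite (_ : (fun N => _) = (fun N => 4 *
    (\sum_(p < N) \sum_(q < N) a p q * (z0 * u) ^+ p * (w0 / u) ^+ q -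
     \sum_(p < N) \sum_(q < N) a' p q * (z0 * u) ^+ p * (w0 / u) ^+ q))).
  exact: HG.
apply/funext => N.
rewrite -sumrB mulr_sumr; apply: eq_bigr => p _.
rewrite -sumrB mulr_sumr; apply: eq_bigr => q _.
rewrite [(z0 * u) ^+ p]exprMn [(w0 / u) ^+ q]exprMn exprVn.
move: (z0 ^+ p) (w0 ^+ q) (u ^+ p) (u ^- q) (a p q) (a' p q) => x1 x2 x3 x4 x5 x6.
by ring.
Qed.

Lemma is_laurE k psi (b : base) l : `|tk k b| < rc (Defs.rad d) ->
  is_laur d k psi b l -> Laur d k psi b = l.
Proof.
move=> tb Hl; apply: (is_laur_unique tb _ Hl).
by have := xgetPex 0 (ex_intro _ l Hl : exists x, [set l | is_laur d k psi b l] x).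
Qed.

End Laur.

(** * Regularity of sections *)

Section Regularity.
Set Implicit Arguments.
Unset Strict Implicit.
Variables (R : realType) (X : surface R) (n m : nat) (d : st_data X n m).
Local Notation C := (Cx R).
Local Notation base := ('rV[C]_n * 'rV[C]_m)%type.
Local Notation c := (rc (Defs.cst d)).

Lemma continuous_near (T U : topologicalType) (f g : T -> U) (x : T) :
  {for x, continuous g} -> (\forall y \near x, g y = f y) -> {for x, continuous f}.
Proof.
move=> cg gf; have e := nbhs_singleton gf.
move: cg; rewrite /prop_for /continuous_at /= e => cg.
exact: cvg_trans (near_eq_cvg gf) cg.
Qed.

Lemma cvg_pairT (T : Type) (U V : topologicalType) (F : set_system T) {FF : Filter F}
    (f : T -> U) (g : T -> V) (a : U) (b : V) :
  f @ F --> a -> g @ F --> b -> (f x, g x) @[x --> F] --> (a, b).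
Proof. by move=> fa gb; exact: (@cvg_pair _ _ _ F (nbhs a) (nbhs b) FF _ _ f g fa gb). Qed.

Lemma continuous_tk k : continuous (@tk R n m k).
Proof.
move=> b; rewrite /tk.
apply: (@cvg_comp _ _ _ (fun b : base => b.2) (fun v : 'rV[C]_m => v 0 k) _ (nbhs b.2)).
  exact: cvg_snd.
exact: coord_continuous.
Qed.

Lemma set_tK k (b : base) : set_t k b (tk k b) = b.
Proof.
case: b => s t; rewrite /set_t /tk /=; congr pair; apply/rowP => l.
by rewrite mxE; case: eqP => [->|].
Qed.

(** Near (x, b) the coefficient is [q * fz w i ^+ 2], and [total_hol] supplies joint continuity of
    [q] and of [fz w i]. *)
Lemma continuous_qo psi i x (b : base) : omega2 d (Base d) psi ->
  outer d x -> dom i x -> Base d b ->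
  {for (x, b), continuous (fun q : X * base => qo psi i q.1 q.2)}.
Proof.
move=> [H _ _ _] ox dx Bb; have [W [w [q [oW Wxb [wh _] qh E]]]] := H x b ox Bb.
have [qc _ _] := qh _ _ Wxb.
have [_ _ /(_ i dx)[_ _ fc]] := wh _ _ Wxb.
apply: (@continuous_near _ _ _ (fun y : X * base => q y.1 y.2 * fz w i y.1 y.2 ^+ 2)).
  apply: cvgM; first exact: qc.
  by rewrite /= expr2; apply: cvgM; exact: fc.
have nW : \forall y \near (x, b), W (y.1, y.2).
  by apply: filterS (open_nbhs_nbhs (conj oW Wxb)) => -[].
have nd : \forall y \near (x, b), dom i y.1.
  have nx : nbhs x (dom i) by apply: open_nbhs_nbhs; split => //; exact: dom_open.
  exact: (@cvg_fst _ _ (nbhs x) (nbhs b) _ _ nx).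
by apply: filterS2 nW nd => y Wy dy; rewrite (E _ _ _ Wy dy).
Qed.

(** The coefficient is meaningful only where z w = t_k, so joint continuity is stated after
    overwriting t_k by z w; (z, w) and the other base parameters are then free coordinates of the
    total space. *)
Lemma continuous_qn psi k z w (b : base) : omega2 d (Base d) psi ->
  in_node d k b z w -> Base d b ->
  {for ((z, w), b), continuous (fun y : (C * C) * base =>
     qn psi k y.1.1 y.1.2 (set_t k y.2 (y.1.1 * y.1.2)))}.
Proof.
move=> [_ H _ _] [zc wc zw] Bb.
have := H k z w b zc wc; rewrite zw set_tK => /(_ Bb) dif.
exact: (differentiable_continuous dif).
Qed.


Lemma differentiable_tk k (b : base) : differentiable (@tk R n m k : base -> C^o) b.
Proof.
have d2 : differentiable (snd : base -> 'rV[C]_m) b.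
  by apply: linear_differentiable => y; exact: cvg_snd.
exact: (differentiable_comp d2 (differentiable_coord b.2 0 k)).
Qed.

Lemma tk_set_t k l (b : base) t : tk l (set_t k b t) = if l == k then t else tk l b.
Proof. by rewrite /tk /set_t /= mxE. Qed.

(** Along a fiber a base function is a constant x; since x passes through both Wirtinger
    derivatives, the equation F_zbar = nu F_z survives multiplication by it. *)
Lemma rdiff_scale (x : C) (F : C -> C) (z : C) : rdiff F z ->
  [/\ rdiff (fun z => x * F z) z, wz (fun z => x * F z) z = x * wz F z &
      wzb (fun z => x * F z) z = x * wzb F z].
Proof.
move=> [rF iF].
have rE : reR (fun z => x * F z) =
    (cRe x *: (reR F : R * R -> R^o)) - (cIm x *: (imR F : R * R -> R^o)) :> (R * R -> R^o).
  apply/funext => q; rewrite /reR /imR !fctE.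
  by case: (x) (F _) => [a b] [a' b'].
have iE : imR (fun z => x * F z) =
    (cRe x *: (imR F : R * R -> R^o)) + (cIm x *: (reR F : R * R -> R^o)) :> (R * R -> R^o).
  apply/funext => q; rewrite /reR /imR !fctE.
  by case: (x) (F _) => [a b] [a' b'].
have dE v : dirder v (fun z => x * F z) z = x * dirder v F z.
  have drF := @diff_derivable _ _ _ _ _ v rF; have diF := @diff_derivable _ _ _ _ _ v iF.
  rewrite /dirder rE iE deriveB; try exact: derivableZ.
  rewrite deriveD; try exact: derivableZ.
  rewrite !deriveZ//; case: (x) => a b.
  by apply/eqP; rewrite eq_complex /= !eqxx.
split.
- split; first by rewrite rE; apply: differentiableB; exact: differentiableZ.
  by rewrite iE; apply: differentiableD; exact: differentiableZ.
- by rewrite /wz /dx /dy !dE; ring.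
- by rewrite /wzb /dx /dy !dE; ring.
Qed.

Lemma is_laur_qscale k psi (g : base -> C) b x : is_laur d k psi b x ->
  is_laur d k (qscale g psi) b (g b * x).
Proof.
move=> [a Ha Hx].
exists (fun p q => g b * a p q).
    move=> z w zw; have [[M HM] Hc] := Ha z w zw; split.
      exists (`|g b| * M) => N.
      apply: le_trans (ler_wpM2l (normr_ge0 (g b)) (HM N)).
      rewrite mulr_sumr; apply: ler_sum => p _.
      rewrite mulr_sumr; apply: ler_sum => q _.
      by rewrite -!mulrA normrM.
    have := cvgMl_tmp (a := g b) Hc.
    rewrite (_ : (fun N => g b * _) = (fun N =>
        \sum_(p < N) \sum_(q < N) g b * a p q * z ^+ p * w ^+ q)).
      by move=> lim; apply: lim.
    apply/funext => N; rewrite mulr_sumr; apply: eq_bigr => p _.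
    by rewrite mulr_sumr; apply: eq_bigr => q _; rewrite !mulrA.
  have := cvgMl_tmp (a := g b) Hx.
  rewrite (_ : (fun N => g b * _) = (fun N => 4 * \sum_(p < N) g b * a p p * tk k b ^+ p)).
    by move=> lim; apply: lim.
  apply/funext => N; rewrite mulrCA; congr (_ * _); rewrite mulr_sumr.
  by apply: eq_bigr => p _; rewrite mulrA.
Qed.

Lemma omega2_qscale U psi l : omega2 d U psi -> omega2 d U (qscale (@tk R n m l) psi).
Proof.
move=> [H1 H2 H3 H4]; split.
- move=> x b ox Ub; have [W [w [q [oW Wxb wh qh E]]]] := H1 x b ox Ub.
  (* The fiber coordinate [w] is kept; the factor t_l goes into the coefficient. *)
  exists W, w, (fun x b => tk l b * q x b); split; [exact: oW|exact: Wxb|exact: wh| |]; last first.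
    by move=> x' b' i Wx' dx' /=; rewrite (E _ _ _ Wx' dx') mulrA.
  move=> x' b' Wx'; have [q1 q2 q3] := qh _ _ Wx'.
  have ct : {for (x', b'), continuous (fun y : X * base => tk l y.2)}.
    apply: (@cvg_comp _ _ _ snd (tk l) _ (nbhs b')); first exact: cvg_snd.
    exact: continuous_tk.
  split.
  + exact: (cvgM ct q1).
  + exact: (differentiableM (differentiable_tk l b') q2).
  + move=> i dx'; have [r1 r2 r3] := q3 i dx'.
    have [s1 s2 s3] := rdiff_scale (tk l b') r1.
    split; first exact: s1.
      by rewrite s3 r2 /fz s2 mulrCA.
    apply: (@continuous_near _ _ _ (fun y : X * base => tk l y.2 * fz q i y.1 y.2)).
      exact: (cvgM ct r3).
    have nW : \forall y \near (x', b'), W (y.1, y.2).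
      by apply: filterS (open_nbhs_nbhs (conj oW Wx')) => -[].
    have nd : \forall y \near (x', b'), dom i y.1.
      have nx : nbhs x' (dom i) by apply: open_nbhs_nbhs; split => //; exact: dom_open.
      exact: (@cvg_fst _ _ (nbhs x') (nbhs b') _ _ nx).
    apply: filterS2 nW nd => y Wy dy.
    have [_ _ /(_ i dy)[t1 _ _]] := qh _ _ Wy.
    by have [_ <- _] := rdiff_scale (tk l y.2) t1.
- move=> k z w b zc wc Ub; have D := H2 k z w b zc wc Ub.
  apply: (differentiableM (f := fun y : (C^o * C^o) * base =>
    tk l (set_t k y.2 (y.1.1 * y.1.2)) : C^o)) D.
  (* On the l-th node piece t_l is the function z w; on the others it remains a base coordinate. *)
  rewrite (_ : (fun y => _) = if l == k then (fun y : (C^o * C^o) * base => (y.1.1 * y.1.2 : C^o))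
      else (fun y : (C^o * C^o) * base => (tk l y.2 : C^o))); last first.
    by apply/funext => y; rewrite tk_set_t; case: ifP.
  have d1 (y : (C^o * C^o) * base) : differentiable (fst : (C^o * C^o) * base -> C^o * C^o) y.
    by apply: linear_differentiable => u; exact: cvg_fst.
  have d2 (y : (C^o * C^o) * base) : differentiable (snd : (C^o * C^o) * base -> base) y.
    by apply: linear_differentiable => u; exact: cvg_snd.
  case: ifP => _; last exact: (differentiable_comp (d2 _) (differentiable_tk l _)).
  have d11 (y : C^o * C^o) : differentiable (fst : C^o * C^o -> C^o) y.
    by apply: linear_differentiable => u; exact: cvg_fst.
  have d12 (y : C^o * C^o) : differentiable (snd : C^o * C^o -> C^o) y.
    by apply: linear_differentiable => u; exact: cvg_snd.
  exact: (differentiableM (differentiable_comp (d1 _) (d11 _))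
                          (differentiable_comp (d1 _) (d12 _))).
- by move=> k b Ub; have [x Hx] := H3 k b Ub; exists (tk l b * x); exact: is_laur_qscale.
- move=> k i x b Ub dx; have [A B] := H4 k i x b Ub dx; split => h1 h2 /=.
    by rewrite (A h1 h2); ring.
  by rewrite (B h1 h2); ring.
Qed.

Lemma omega2_sub U V psi : V `<=` U -> omega2 d U psi -> omega2 d V psi.
Proof.
move=> VU [H1 H2 H3 H4]; split.
- by move=> x b ox /VU; exact: H1.
- by move=> k z w b zc wc /VU; exact: H2.
- by move=> k b /VU; exact: H3.
- by move=> k i x b /VU; exact: H4.
Qed.

End Regularity.

(** * Compactness and charts *)

Section Compactness.
Set Implicit Arguments.
Unset Strict Implicit.
Variable R : realType.
Local Notation C := (Cx R).

(** A tube lemma with bounds: the pair (n, b) runs along the product filter of [\oo] and [nbhs p],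
    and near-covering compactness merges the local bounds, monotonicity in n making each valid for
    all large n. *)
Lemma compact_unif (T S : topologicalType) (K : set T) (p : S) (P : nat -> S -> T -> Prop) :
  compact K -> (forall n n' b x, (n <= n')%N -> P n b x -> P n' b x) ->
  (forall x, K x -> exists n, \forall y \near (x, p), P n y.2 y.1) ->
  exists n, \forall b \near p, forall x, K x -> P n b x.
Proof.
move=> cK mono loc.
pose F : set_system (nat * S) := filter_prod \oo (nbhs p).
have := (compact_near_coveringP K).1 cK _ F (fun i x => P i.1 i.2 x) _.
case=> [x Kx|].
  have [n [[A B] /= [Ax Bp] AB]] := loc x Kx.
  exists (A, [set i : nat * S | (n <= i.1)%N /\ B i.2]) => /=.
    split => //; exists ([set k | (n <= k)%N], B) => /=.
      by split => //; exists n.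
    by move=> [k b] [] /=.
  move=> [y [k b]] /= [Ay [nk Bb]]; apply: (mono n) => //.
  exact: (AB (y, b)).
move=> [A B] /= [[n _ nA] Bp] AB; exists n.
apply: filterS Bp => b Bb x Kx.
by apply: (AB (n, b)) => //; split => //=; apply: nA => /=.
Qed.

Lemma cvg_norm_bounded (T : Type) (F : set_system T) {FF : Filter F} (f : T -> C) (l : C) :
  f @ F --> l -> exists n : nat, \forall x \near F, `|f x| <= n%:R.
Proof.
move=> fl; have [n ln] := normC_lt_nat l; exists n.+1.
have := @cvgr_dist_lt _ _ _ _ FF _ _ fl 1 ltr01.
apply: filterS => x lx; rewrite -natr1 -[f x](subrK l) addrC.
apply: le_trans (ler_normD _ _) _; rewrite lerD ?(ltW ln)//.
by rewrite distrC ltW.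
Qed.

Lemma cvg_norm_lt (T : Type) (F : set_system T) {FF : Filter F} (f : T -> C) (l a : C) :
  f @ F --> l -> `|l| < a -> \forall x \near F, `|f x| < a.
Proof.
rewrite -subr_gt0 => fl la; have := @cvgr_dist_lt _ _ _ _ FF _ _ fl _ la.
apply: filterS => x lx; rewrite -[f x](subrK l) addrC.
by apply: le_lt_trans (ler_normD _ _) _; rewrite addrC -ltrBrDr distrC.
Qed.

Lemma cvg_norm_gt (T : Type) (F : set_system T) {FF : Filter F} (f : T -> C) (l a : C) :
  f @ F --> l -> a < `|l| -> \forall x \near F, a < `|f x|.
Proof.
rewrite -subr_gt0 => fl la; have := @cvgr_dist_lt _ _ _ _ FF _ _ fl _ la.
apply: filterS => x lx.
have : `|l| <= `|l - f x| + `|f x| by rewrite -[in leLHS](subrK (f x) l) ler_normD.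
rewrite -lerBlDl => /(lt_le_trans _); apply.
by rewrite ltrBrDl -ltrBrDr.
Qed.

Lemma compact_norm_bounded (T : topologicalType) (K : set T) (f : T -> C) :
  compact K -> (forall x, K x -> {for x, continuous f}) ->
  exists n : nat, forall x, K x -> `|f x| <= n%:R.
Proof.
move=> cK cf.
have [|x Kx|n /nbhs_singleton H] := @compact_unif T C K 0
   (fun n _ x => `|f x| <= n%:R) cK.
- by move=> n n' _ x nn' /le_trans; apply; rewrite ler_nat.
- have [n Hn] := cvg_norm_bounded (cf x Kx).
  exists n; exact: (@cvg_fst _ _ (nbhs x) (nbhs (0 : C)) _ _ Hn).
by exists n.
Qed.

Lemma compact_cdisc (s : R) : compact [set z : C | `|z| <= rc s].
Proof.
have cs : compact (`[- s, s]%classic `*` `[- s, s]%classic : set (R * R)).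
  by apply: compact_setX; exact: segment_compact.
have ci : compact (@ofplane R @` (`[- s, s]%classic `*` `[- s, s]%classic)).
  by apply: continuous_compact => //; apply: continuous_subspaceT; exact: continuous_ofplane.
apply: (subclosed_compact _ ci).
  rewrite (_ : [set _ | _] = (fun z : C => cRe `|z|) @^-1` [set x | x <= s]).
    apply: closed_comp; last exact: closed_le.
    move=> z _; apply: (@cvg_comp _ _ _ _ _ _ (nbhs `|z|)); last exact: continuous_cRe.
    exact: (@norm_continuous _ C).
  have E (z : C) : (`|z| <= rc s) = (cRe `|z| <= s).
    by have [x _ ->] := normC_rc z; rewrite ler_rc.
  apply/seteqP; split => z h.
    by change (cRe `|z| <= s); rewrite -E; exact: h.
  by change (`|z| <= rc s); rewrite E; exact: h.
move=> z /= zr; exists (toplane z); last exact: toplaneK.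
have H (x : R) : rc `|x| <= `|z| -> - s <= x <= s.
  by move=> /le_trans/(_ zr); rewrite ler_rc ler_norml.
split; rewrite /= in_itv /=; apply: H; first exact: norm_cRe.
exact: norm_cIm.
Qed.

End Compactness.

(** * Borel subsets of the surface, read in charts *)

Section Cells.
Set Implicit Arguments.
Unset Strict Implicit.
Variables (R : realType) (X : surface R).
Local Notation C := (Cx R).

Lemma chart_open i (A : set X) : open A -> open (zc i @` (dom i `&` A)).
Proof.
move=> oA; rewrite openE => _ /= [x [dx Ax] <-].
have n1 : nbhs (zc i x) (zc i @` dom i).
  by apply: open_nbhs_nbhs; split; [exact: zc_open|exists x].
have n2 : nbhs (zc i x) (zinv i @^-1` A).
  have nA : nbhs (zinv i (zc i x)) A.
    by rewrite (zcK dx); apply: open_nbhs_nbhs; split.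
  exact: (zinv_cont dx nA).
apply: filterS2 n1 n2 => y [x' dx' <-] /=; rewrite zcK// => Ax'.
by exists x'.
Qed.

(** The surface has no sigma-algebra of its own. Since [zc i] is injective on [dom i], taking traces
    in charts commutes with Boolean operations, so this class is stable under them. *)
Definition chart_borel (A : set X) : Prop := forall i, cborel (zc i @` (dom i `&` A)).

Lemma chart_borel_open A : open A -> chart_borel A.
Proof. by move=> oA i; apply: cborel_open; exact: chart_open. Qed.

Lemma chart_borelC A : chart_borel A -> chart_borel (~` A).
Proof.
move=> bA i; rewrite (_ : zc i @` _ = zc i @` (dom i `&` setT) `\` zc i @` (dom i `&` A)).
  by apply: cborelD => //; apply: cborel_open; apply: chart_open; exact: openT.
apply/seteqP; split => [_ [x [dx nAx] <-]|_ [[x [dx _] <-] nA]].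
  split; first by exists x.
  by move=> [y [dy Ay]] /(congr1 (zinv i)); rewrite !zcK// => yx; apply: nAx; rewrite -yx.
by exists x => //; split => // Ax; apply: nA; exists x.
Qed.

Lemma chart_borelI A B : chart_borel A -> chart_borel B -> chart_borel (A `&` B).
Proof.
move=> bA bB i; rewrite (_ : zc i @` _ = zc i @` (dom i `&` A) `&` zc i @` (dom i `&` B)).
  exact: cborelI.
apply/seteqP; split => [_ [x [dx [Ax Bx]] <-]|_ [[x [dx Ax] <-] [y [dy By]]]].
  by split; exists x.
move=> /(congr1 (zinv i)); rewrite !zcK// => yx; exists x => //; split => //.
by split => //; rewrite -yx.
Qed.

Lemma chart_borel_bigcup (I : finType) (A : I -> set X) :
  (forall a, chart_borel (A a)) -> chart_borel (\bigcup_a A a).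
Proof.
move=> bA i; rewrite (_ : zc i @` _ = \bigcup_a (zc i @` (dom i `&` A a))).
  by apply: cborel_bigcup => a; exact: bA.
apply/seteqP; split => [_ [x [dx [a _ Ax]] <-]|_ [a _ [x [dx Ax] <-]]].
  by exists a => //; exists x.
by exists x => //; split => //; exists a.
Qed.

Lemma chart_borel_core j : chart_borel (@core R X j).
Proof.
rewrite -(setCK (core j)); apply: chart_borelC; apply: chart_borel_open.
apply: closed_openC; apply: compact_closed; first exact: surf_hausdorff.
exact: core_compact.
Qed.

Lemma core_bounded i : exists N : nat, forall x : X, core i x -> `|zc i x| <= N%:R.
Proof.
apply: compact_norm_bounded; first exact: core_compact.
by move=> x /core_sub dx; exact: zc_cont.
Qed.

Lemma coef_cont (f : C -> C) i (x : X) : dom i x ->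
  {for zc i x, continuous f} -> {for x, continuous (fun y => f (zc i y))}.
Proof. by move=> dx cf; exact: (cvg_comp (zc i) f (zc_cont dx) cf). Qed.

Variables (n m : nat) (d : st_data X n m).
Local Notation base := ('rV[C]_n * 'rV[C]_m)%type.
Local Notation c := (rc (Defs.cst d)).
Hypothesis c01 : 0 < Defs.cst d < 1.
Hypothesis lc : local_coordinates d.

Lemma zeta_cont e k x : cdom d e k x -> {for x, continuous (zeta d e k)}.
Proof.
case: lc => _ _ _ hol _ cx; have [i cix] := core_cover x.
have dx := core_sub cix.
have cz : {for zc i x, continuous (zeta d e k \o zinv i)}.
  have := hol e k x cx i dx => /derivable1_diffP dz; exact: (differentiable_continuous dz).
apply: (@continuous_near _ _ _ (fun y => (zeta d e k \o zinv i) (zc i y))).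
  exact: coef_cont.
have nd : \forall y \near x, dom i y by apply: open_nbhs_nbhs; split => //; exact: dom_open.
by apply: filterS nd => y dy /=; rewrite zcK.
Qed.

Lemma cdom_lt_open e k (r : R) : open (cdom d e k `&` [set x | `|zeta d e k x| < rc r]).
Proof.
rewrite openE => x /= [cx zx].
have oc : open (cdom d e k) by case: lc => /(_ e k)[].
have n1 : nbhs x (cdom d e k) := open_nbhs_nbhs (conj oc cx).
have n2 : nbhs x [set y | `|zeta d e k y| < rc r].
  exact: (cvg_norm_lt (zeta_cont cx) zx).
by apply: filterS2 n1 n2.
Qed.

End Cells.

(** * Cells of the pairing *)

Section CellBounds.
Set Implicit Arguments.
Unset Strict Implicit.
Variables (R : realType) (X : surface R) (n m : nat) (d : st_data X n m).
Local Notation C := (Cx R).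
Local Notation base := ('rV[C]_n * 'rV[C]_m)%type.
Local Notation c := (rc (Defs.cst d)).
Hypothesis c01 : 0 < Defs.cst d < 1.
Hypothesis lc : local_coordinates d.

Let cc := Defs.cst d.

Lemma cutE : Defs.cut d = rc ((cc + cc ^+ 2) / 2).
Proof. by rewrite /Defs.cut /rc /= rmorphM rmorphD rmorphXn fmorphV rmorph_nat. Qed.

(** The cut circle lies strictly inside the collar where the pieces overlap, which leaves room for
    compactness on both sides of it. *)
Lemma cut_bounds : [/\ c ^+ 2 < Defs.cut d, Defs.cut d < c & 0 < Defs.cut d].
Proof.
have c2 : c ^+ 2 = rc (cc ^+ 2) by rewrite /rc /= rmorphXn.
rewrite cutE c2 -[(0 : C)]/(rc 0) !ltr_rc.
case/andP: c01 => c0 c1; have cc1 : cc ^+ 2 < cc by rewrite expr2 gtr_pMr.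
have cc0 : 0 < cc ^+ 2 by rewrite exprn_gt0.
by split; move: cc1 cc0 c0; rewrite -/cc; set u := cc ^+ 2; lra.
Qed.

(** The condition defining [outer] constrains only points of the open coordinate domains, so the
    complement is a finite union of differences of open sets. *)
Lemma chart_borel_outer : chart_borel (outer d).
Proof.
rewrite (_ : outer d = ~` \bigcup_(a : bool * 'I_m)
    (cdom d a.1 a.2 `&` ~` (cdom d a.1 a.2 `&` [set x | c ^+ 2 < `|zeta d a.1 a.2 x|]))).
  apply: chart_borelC; apply: chart_borel_bigcup => -[e k] /=.
  have oc : open (cdom d e k) by case: lc => /(_ e k)[].
  apply: chart_borelI; first exact: chart_borel_open.
  apply: chart_borelC; apply: chart_borel_open.
  rewrite openE => x /= [cx zx].
  have n1 : nbhs x (cdom d e k) := open_nbhs_nbhs (conj oc cx).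
  have n2 : \forall y \near x, c ^+ 2 < `|zeta d e k y|.
    exact: (cvg_norm_gt (zeta_cont lc cx) zx).
  exact: (filterI n1 n2).
apply/seteqP; split => [x ox [[e k] _ /= [cx H]]|x H e k cx].
  by apply: H; split => //; exact: ox.
by apply: contrapT => H1; apply: H; exists (e, k) => //=; split => // -[_ /H1].
Qed.

Definition near_marks : set X :=
  \bigcup_(a : bool * 'I_m) (cdom d a.1 a.2 `&` [set x | `|zeta d a.1 a.2 x| < Defs.cut d]).

Lemma near_marks_open : open near_marks.
Proof. by apply: bigcup_open => -[e k] _ /=; rewrite cutE; exact: cdom_lt_open. Qed.

Lemma far_marksP x : (~` near_marks) x <->
  (forall e k, cdom d e k x -> Defs.cut d <= `|zeta d e k x|).
Proof.
have [_ _ c0] := cut_bounds.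
split => [H e k cx|H [[e k] _ /= [cx]]].
  have [//|lt] := real_leP (gtr0_real c0) (normr_real (zeta d e k x)).
  by exfalso; apply: H; exists (e, k).
by move/(le_lt_trans (H e k cx)); rewrite ltxx.
Qed.

(** A compact set containing the i-th cell, on which bounds can be taken; the cell itself also
    excludes the earlier cores and need not be closed. *)
Definition core_far i : set X := core i `&` ~` near_marks.

Lemma core_far_compact i : compact (core_far i).
Proof.
apply: compact_closedI; first exact: core_compact.
by apply: open_closedC; exact: near_marks_open.
Qed.

Lemma core_far_outer i : core_far i `<=` outer d `&` dom i.
Proof.
move=> x [cx /far_marksP fx]; split; last exact: core_sub.
by move=> e k /fx; apply: lt_le_trans; case: cut_bounds.
Qed.

Lemma outer_cell_far i : outer_cell d i `<=` core_far i.
Proof. by move=> x [cx _ fx]; split => //; apply/far_marksP. Qed.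

Lemma cborel_outer_cell i : cborel (zc i @` outer_cell d i).
Proof.
pose A := core i `&`
  (~` (\bigcup_(j : 'I_(nch X)) (if (j < i)%N then core j else set0)) `&` ~` near_marks).
rewrite (_ : outer_cell d i = dom i `&` A).
  have : chart_borel A; last by apply.
  apply: chart_borelI; first exact: chart_borel_core.
  apply: chart_borelI; apply: chart_borelC; last first.
    by apply: chart_borel_open; exact: near_marks_open.
  apply: chart_borel_bigcup => j; case: ifP => _; first exact: chart_borel_core.
  by apply: chart_borel_open; exact: open0.
apply/seteqP; split => [x [cx H fx]|x [dx [cx [H /far_marksP fx]]]].
  split; first exact: core_sub.
  split => //; split; last exact/far_marksP.
  by move=> [j _]; case: ifP => // ji; exact: H.
split => // j ji cj; apply: H; exists j => //; by rewrite ji.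
Qed.

Lemma outer_cell_sub i : zc i @` outer_cell d i `<=` zc i @` (dom i `&` outer d).
Proof.
by move=> _ [x /outer_cell_far/core_far_outer[ox dx] <-]; exists x.
Qed.

Lemma qo_chart_cont psi i z (b : base) : omega2 d (Base d) psi -> Base d b ->
  (zc i @` (dom i `&` outer d)) z ->
  {for z, continuous (fun z => qo psi i (zinv i z) b)}.
Proof.
move=> om Bb [x [dx ox] <-].
have H : (zinv i y, b) @[y --> zc i x] --> (zinv i (zc i x), b).
  have cz : {for zc i x, continuous (zinv i)} := zinv_cont dx.
  have cb : (fun=> b) @ zc i x --> b by exact (@cvg_cst _ b _ (nbhs (zc i x)) _).
  exact (cvg_pairT cz cb).
have cq := continuous_qo om ox dx Bb.
rewrite /prop_for /continuous_at /=.
rewrite zcK// in H *.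
exact: (cvg_comp _ _ H cq).
Qed.

Lemma qo_bounded psi i (p : base) : omega2 d (Base d) psi -> Base d p ->
  exists B : nat, \forall b \near p, forall x, core_far i x -> `|qo psi i x b| <= B%:R.
Proof.
move=> om Bp.
apply: (@compact_unif X _ (core_far i) p (fun k b x => `|qo psi i x b| <= k%:R)).
- exact: core_far_compact.
- by move=> k k' b' x kk' /le_trans; apply; rewrite ler_nat.
move=> x /core_far_outer[ox dx].
exact: (cvg_norm_bounded (continuous_qo om ox dx Bp)).
Qed.

(** [z] stands for z_k or w_k according to [e], so that each estimate is proved once for the two
    branches of a node. *)
Definition node_coef (e : bool) (k : 'I_m) (psi : qd X n m) (z : C) (b : base) : C :=
  if e then qn psi k (tk k b / z) z b else qn psi k z (tk k b / z) b.

Definition half_node (e : bool) (k : 'I_m) (b : base) : set C :=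
  if e then [set w | `|tk k b| < `|w| ^+ 2 /\ `|w| < Defs.cut d]
  else [set z | `|tk k b| <= `|z| ^+ 2 /\ `|z| < Defs.cut d].

Lemma half_nodeP e k b z : half_node e k b z -> `|tk k b| <= `|z| ^+ 2 /\ `|z| < Defs.cut d.
Proof. by case: e => -[h1 h2]; split => //; exact: ltW. Qed.

(** The half contains the origin only for [e = false] and t_k = 0; there t_k / z and 1 / z^2 are
    mere default values. *)
Definition punctured_half e k b : set C := half_node e k b `&` [set z | z != 0].

Lemma punctured_half_annulus e k b : punctured_half e k b `<=` annulus d k b.
Proof.
have [_ cc' c0] := cut_bounds.
move=> z [/half_nodeP[tz zc] z0]; split; last exact: lt_trans zc cc'.
apply: (le_lt_trans tz); rewrite expr2 ltr_pM2r ?normr_gt0//.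
exact: lt_trans zc cc'.
Qed.

Lemma annulus_neq0 k b z : annulus d k b z -> z != 0.
Proof.
move=> [tz _]; apply/eqP => z0; move: tz; rewrite z0 normr0 mulr0.
by move=> /(le_lt_trans (normr_ge0 _)); rewrite ltxx.
Qed.

Lemma annulus_in_node k b z : annulus d k b z ->
  in_node d k b z (tk k b / z) /\ in_node d k b (tk k b / z) z.
Proof.
move=> az; have z0 := annulus_neq0 az; case: az => tz zc.
have tzc : `|tk k b / z| < c.
  by rewrite normrM normfV ltr_pdivrMr ?normr_gt0.
by split; split => //; [rewrite mulrC divfK|rewrite divfK].
Qed.

Lemma node_coef_cont e psi k (b : base) (y : C * base) : omega2 d (Base d) psi ->
  Base d b -> y.2 = b -> annulus d k b y.1 ->
  {for y, continuous (fun y : C * base => node_coef e k psi y.1 y.2)}.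
Proof.
case: y => z b' om Bb /= ->.
move=> az; have z0 := annulus_neq0 az; have [n1 n2] := annulus_in_node az.
have cz : (fun y : C * base => y.1) @ (z, b) --> z by exact: cvg_fst.
have cb : (fun y : C * base => y.2) @ (z, b) --> b by exact: cvg_snd.
have ct : (fun y : C * base => tk k y.2) @ (z, b) --> tk k b.
  exact: (cvg_comp _ _ cb (@continuous_tk R n m k b)).
have cw : (fun y : C * base => tk k y.2 / y.1) @ (z, b) --> tk k b / z.
  exact: (cvgM ct (cvgV z0 cz)).
have nz : \forall y \near (z, b), y.1 != 0.
  have h : 0 < `|z| by rewrite normr_gt0.
  apply: filterS (cvg_norm_gt cz h) => y; by rewrite normr_gt0.
rewrite /node_coef; case: e.
  have cG := continuous_qn om n2 Bb.
  have H : ((tk k y.2 / y.1, y.1), y.2) @[y --> (z, b)] --> ((tk k b / z, z), b).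
    exact: (cvg_pairT (cvg_pairT cw cz) cb).
  (* Where z is nonzero, (t_k / z) z = t_k, so overwriting t_k changes nothing. *)
  apply: (@continuous_near _ _ _ _ _ (cvg_comp _ _ H cG)).
  by apply: filterS nz => y y0 /=; rewrite divfK// set_tK.
have cG := continuous_qn om n1 Bb.
have H : ((y.1, tk k y.2 / y.1), y.2) @[y --> (z, b)] --> ((z, tk k b / z), b).
  exact: (cvg_pairT (cvg_pairT cz cw) cb).
apply: (@continuous_near _ _ _ _ _ (cvg_comp _ _ H cG)).
by apply: filterS nz => y y0 /=; rewrite [y.1 * _]mulrC divfK// set_tK.
Qed.

(** The punctured halves are not compact and degenerate as t_k tends to 0, so the bound is taken
    over the closed bidisc |z|, |w| <= cut, which contains them because |t_k / z| <= |z|. Near a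
    point with zw = t_k(p) continuity bounds the coefficient; near any other point the constraint zw
    = t_k(b) fails, leaving nothing to bound. *)
Lemma node_coef_bounded psi k (p : base) : omega2 d (Base d) psi -> Base d p ->
  exists B : nat, \forall b \near p, forall e z, punctured_half e k b z ->
    `|node_coef e k psi z b| <= B%:R.
Proof.
move=> om Bp; have [_ cltc c0] := cut_bounds.
pose K : set (C * C) := [set z | `|z| <= Defs.cut d] `*` [set z | `|z| <= Defs.cut d].
have cK : compact K by rewrite /K cutE; apply: compact_setX; exact: compact_cdisc.
have [||B HB] := @compact_unif _ _ K p
  (fun i (b : base) (y : C * C) => y.1 * y.2 = tk k b -> `|qn psi k y.1 y.2 b| <= i%:R) cK.
- by move=> i i' b' x ii' H /H /le_trans; apply; rewrite ler_nat.
- move=> [z w] [/= zc wc].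
  have [zw|zw] := eqVneq (z * w) (tk k p).
    have nd : in_node d k p z w.
      by split => //; [exact: le_lt_trans zc cltc|exact: le_lt_trans wc cltc].
    have [i Hi] := cvg_norm_bounded (continuous_qn om nd Bp).
    by exists i; apply: filterS Hi => -[[z' w'] b] /= + zw'; rewrite zw' set_tK.
  exists 0%N.
  have h : 0 < `|z * w - tk k p| by rewrite normr_gt0 subr_eq0.
  have cf : (fun y : (C * C) * base => y.1.1 * y.1.2 - tk k y.2) @ ((z, w), p) --> z * w - tk k p.
    apply: cvgB; last first.
      apply: (@cvg_comp _ _ _ snd (tk k) _ (nbhs p)); first exact: cvg_snd.
      exact: continuous_tk.
    apply: cvgM.
      apply: (@cvg_comp _ _ _ fst fst _ (nbhs (z, w))); first exact: cvg_fst.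
      exact: cvg_fst.
    apply: (@cvg_comp _ _ _ fst snd _ (nbhs (z, w))); first exact: cvg_fst.
    exact: cvg_snd.
  apply: filterS (cvg_norm_gt cf h) => -[[z' w'] b] /=.
  by rewrite normr_gt0 subr_eq0 => /eqP.
exists B; apply: filterS HB => b Hb e z pz.
have [hz z0] := pz; have [tz zc] := half_nodeP hz.
have tzc : `|tk k b / z| <= Defs.cut d.
  rewrite normrM normfV ler_pdivrMr ?normr_gt0//; apply: (le_trans tz).
  by rewrite expr2 ler_wpM2r// ltW.
rewrite /node_coef; case: e {pz hz} => [].
  by apply: (Hb (tk k b / z, z)); [split => //; exact: ltW|rewrite divfK].
by apply: (Hb (z, tk k b / z)); [split => //; exact: ltW|rewrite mulrC divfK].
Qed.

End CellBounds.

(** * Linearity of the pairing *)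

Section Pairing.
Set Implicit Arguments.
Unset Strict Implicit.
Variables (R : realType) (X : surface R) (n m : nat) (d : st_data X n m).
Local Notation C := (Cx R).
Local Notation base := ('rV[C]_n * 'rV[C]_m)%type.
Local Notation c := (rc (Defs.cst d)).
Local Notation ix := ('I_n + 'I_m)%type.
Hypothesis c01 : 0 < Defs.cst d < 1.
Hypothesis lc : local_coordinates d.

Definition outer_density i (b : base) (mu : fbeltrami X m) (psi : qd X n m) (z : C) : C :=
  mo mu i (zinv i z) * qo psi i (zinv i z) b.

Definition node_density e k (b : base) (mu : fbeltrami X m) (psi : qd X n m) (z : C) : C :=
  mn mu e k z * (4 * node_coef e k psi z b / z ^+ 2).

Definition outer_term i b mu psi : C :=
  area_int (zc i @` outer_cell d i) (outer_density i b mu psi).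

Definition node_term e k b mu psi : C :=
  area_int (half_node d e k b) (node_density e k b mu psi).

Lemma fpairE b mu psi : fpair d b mu psi =
  \sum_i outer_term i b mu psi +
  \sum_k (node_term false k b mu psi + node_term true k b mu psi).
Proof. by []. Qed.

Lemma eq_fpair b mu psi chi : qd_eq_at d b psi chi -> fpair d b mu psi = fpair d b mu chi.
Proof.
move=> [eo en]; rewrite !fpairE; congr (_ + _).
  apply: eq_bigr => i _; apply: eq_area_int => _ [x cx <-].
  have [ox dx] := core_far_outer c01 (outer_cell_far c01 cx).
  by rewrite /outer_density zcK// eo.
have H e k : node_term e k b mu psi = node_term e k b mu chi.
  apply: eq_area_int => z hz; rewrite /node_density.
  (* At the origin both densities are 0 by the convention 0^-1 = 0. *)
  have [->|z0] := eqVneq z 0; first by rewrite expr0n invr0 !mulr0.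
  have [n1 n2] := annulus_in_node (punctured_half_annulus c01 (conj hz z0)).
  by congr (_ * (_ * _ / _)); rewrite /node_coef; case: e {hz} => /=; apply: en.
by apply: eq_bigr => k _; rewrite !H.
Qed.

(* Away from 0 the density of the node term is bounded by [M * (4 * B / del)];
   at 0 it vanishes because [0^-1 = 0]. *)
Definition node_ctrl k (b : base) (mu : fbeltrami X m) (M del : C) : Prop :=
  [/\ 0 <= M, 0 < del & forall e z, punctured_half d e k b z ->
    `|mn mu e k z| <= M /\ (mn mu e k z = 0 \/ del <= `|z| ^+ 2)].

(** What makes every density of the pairing integrable. It covers alike the Kodaira-Spencer
    differentials, those supported off the nodes and the members near p of a convergent family. *)
Definition pairable (b : base) (mu : fbeltrami X m) : Prop :=
  [/\ forall i, cmeasurable (zc i @` (dom i `&` outer d)) (mo mu i \o zinv i),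
      forall i, exists M : C, forall x, core_far d i x -> `|mo mu i x| <= M,
      forall e k, cmeasurable (annulus d k b) (mn mu e k) &
      forall k, exists M del, node_ctrl k b mu M del].

Lemma cborel_outer_chart i : cborel (zc i @` (dom i `&` outer d)).
Proof. exact: chart_borel_outer. Qed.

Lemma cmeasurable_outer_density i b mu psi : omega2 d (Base d) psi -> Base d b ->
  cmeasurable (zc i @` (dom i `&` outer d)) (mo mu i \o zinv i) ->
  cmeasurable (zc i @` outer_cell d i) (outer_density i b mu psi).
Proof.
move=> om Bb mm; apply: (cmeasurable_sub (outer_cell_sub c01 (i := i)) (cborel_outer_chart i)).
apply: cmeasurableM; first exact: mm.
apply: cmeasurable_continuous; first exact: cborel_outer_chart.
by move=> z; exact: qo_chart_cont.
Qed.

Lemma outer_cell_bounded i : exists N : nat, forall z, (zc i @` outer_cell d i) z -> `|z| <= N%:R.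
Proof.
have [N HN] := core_bounded i; exists N => _ [x [cx _ _] <-]; exact: HN.
Qed.

Lemma cint_outer i b mu psi : omega2 d (Base d) psi -> Base d b -> pairable b mu ->
  cint (zc i @` outer_cell d i) (outer_density i b mu psi).
Proof.
move=> om Bb [mm mb _ _]; have [N HN] := outer_cell_bounded i.
have [M HM] := mb i; have [B /nbhs_singleton HB] := qo_bounded c01 lc i om Bb.
apply: (cint_bounded (M := N%:R) (B := M * B%:R)) => //.
- exact: cborel_outer_cell.
- exact: cmeasurable_outer_density.
move=> _ [x cx <-]; have fx := outer_cell_far c01 cx.
have [_ dx] := core_far_outer c01 fx.
by rewrite /outer_density zcK// normrM ler_pM// ?HM ?HB.
Qed.

(** Extension by zero to a disc independent of [b], so that integrals over different fibers become
    integrals over one domain. *)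
Definition patched e k b mu psi (z : C) : C :=
  if `[< punctured_half d e k b z >] then node_density e k b mu psi z else 0.

Definition cut_disc : set C := [set z | `|z| < Defs.cut d].

Lemma cborel_cut_disc : cborel cut_disc.
Proof.
apply: cborel_open; rewrite openE => z /= zc.
exact: (cvg_norm_lt (@cvg_id _ (nbhs z)) zc).
Qed.

Lemma cborel_annulus k b : cborel (annulus d k b).
Proof.
apply: cborel_open; rewrite openE => z [/= tz zc].
have c0 : (0 : C) < c by rewrite -[0]/(rc 0) ltr_rc; case/andP: c01.
have n1 : \forall y \near z, `|y| < c by exact: (cvg_norm_lt (@cvg_id _ (nbhs z)) zc).
have tz' : `|tk k b| / c < `|z| by rewrite ltr_pdivrMr// mulrC.
have n2 : \forall y \near z, `|tk k b| / c < `|y| by exact: (cvg_norm_gt (@cvg_id _ (nbhs z)) tz').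
have n3 : \forall y \near z, annulus d k b y.
  have n12 : \forall y \near z, `|y| < c /\ `|tk k b| / c < `|y| by exact: (filterI n1 n2).
  apply: (@filterS _ (nbhs z) _ _ _ _ n12) => y [yc ty]; split => //.
  by rewrite mulrC -ltr_pdivrMr.
exact: n3.
Qed.

Lemma cborel_punctured_half e k b : cborel (punctured_half d e k b).
Proof.
have sq (z : C) : `|w| ^+ 2 @[w --> z] --> `|z| ^+ 2 := @continuous_sqrnorm R z.
have real2 (z : C) : `|z| ^+ 2 \is Num.real by rewrite realX// normr_real.
have norm2 (z : C) : `| `|z| ^+ 2 | = `|z| ^+ 2 by rewrite normrX normr_id.
have o1 : open [set z : C | `|tk k b| < `|z| ^+ 2].
  rewrite openE => z /= h; rewrite -(norm2 z) in h.
  by apply: filterS (cvg_norm_gt (sq z) h) => y; rewrite norm2.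
have o2 : open [set z : C | `|z| ^+ 2 < `|tk k b|].
  rewrite openE => z /= h; rewrite -(norm2 z) in h.
  by apply: filterS (cvg_norm_lt (sq z) h) => y; rewrite norm2.
have o3 : open [set z : C | z != 0].
  rewrite openE => z /= h; rewrite -normr_gt0 in h.
  by apply: filterS (cvg_norm_gt (@cvg_id _ (nbhs z)) h) => y; rewrite normr_gt0.
apply: cborelI; last exact: cborel_open.
rewrite /half_node; case: e.
  by apply: cborelI; [exact: cborel_open|exact: cborel_cut_disc].
have cl : cborel [set z : C | `|tk k b| <= `|z| ^+ 2].
  rewrite (_ : [set z : C | _] = ~` [set z : C | `|z| ^+ 2 < `|tk k b|]).
    by apply: cborelC; exact: cborel_open.
  apply/seteqP; split => z /= h.
    by move=> /(le_lt_trans h); rewrite ltxx.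
  by have [//|lt] := real_leP (normr_real (tk k b)) (real2 z).
exact: (cborelI cl cborel_cut_disc).
Qed.

Lemma node_termE e k b mu psi :
  node_term e k b mu psi = area_int cut_disc (patched e k b mu psi).
Proof.
rewrite /patched; apply: area_int_patch.
- move=> z hz _; case: asboolP => // nz.
  have [->|z0] := eqVneq z 0; first by rewrite /node_density expr0n invr0 !mulr0.
  by exfalso; apply: nz.
- by move=> z /half_nodeP[_ ? []].
- by move=> z nh _; case: asboolP => // -[].
Qed.

Lemma cmeasurable_patched e k b mu psi : omega2 d (Base d) psi -> Base d b ->
  cmeasurable (annulus d k b) (mn mu e k) -> cmeasurable cut_disc (patched e k b mu psi).
Proof.
move=> om Bb mm; apply: cmeasurable_patch.
- exact: cborel_punctured_half.
- by move=> z [/half_nodeP[]].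
- exact: cborel_cut_disc.
refine (cmeasurable_sub _ (cborel_annulus k b) _); first exact: punctured_half_annulus.
apply: cmeasurableM; first exact: mm.
apply: cmeasurable_continuous; first exact: cborel_annulus.
move=> z az; have z0 := annulus_neq0 az.
have cn : (fun z => node_coef e k psi z b) @ z --> node_coef e k psi z b.
  have cc := node_coef_cont (e := e) (y := (z, b)) om Bb erefl az.
  have H : (w, b) @[w --> z] --> (z, b).
    exact: (cvg_pairT (@cvg_id _ (nbhs z)) (@cvg_cst _ b _ (nbhs z) _)).
  exact: (cvg_comp _ _ H cc).
have c4 : (fun z => 4 * node_coef e k psi z b) @ z --> 4 * node_coef e k psi z b.
  exact: (cvgMl_tmp cn).
have c2 : (fun w : C => w ^+ 2) @ z --> z ^+ 2.
  by rewrite expr2; exact: (cvgM (@cvg_id _ (nbhs z)) (@cvg_id _ (nbhs z))).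
have z20 : z ^+ 2 != 0 by rewrite expf_neq0.
exact: (cvgM c4 (cvgV z20 c2)).
Qed.

Lemma patched_bound e k b mu psi M del (B : nat) z : node_ctrl k b mu M del ->
  (forall e z, punctured_half d e k b z -> `|node_coef e k psi z b| <= B%:R) ->
  `|patched e k b mu psi z| <= M * (4 * B%:R / del).
Proof.
move=> [M0 del0 H] HB.
have b0 : 0 <= M * (4 * B%:R / del) by rewrite mulr_ge0// divr_ge0 ?mulr_ge0// ltW.
rewrite /patched; case: asboolP => [pz|_]; last by rewrite normr0.
rewrite /node_density; have [mM [->|dz]] := H _ _ pz; first by rewrite mul0r normr0.
rewrite normrM ler_pM// normrM ler_pM//.
  by rewrite normrM normr_nat ler_wpM2l// HB.
rewrite normfV normrX lef_pV2// posrE; exact: lt_le_trans dz.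
Qed.

Lemma cint_node e k b mu psi : omega2 d (Base d) psi -> Base d b -> pairable b mu ->
  cint cut_disc (patched e k b mu psi).
Proof.
move=> om Bb [_ _ mm ctl]; have [M [del Hc]] := ctl k.
have [B /nbhs_singleton HB] := node_coef_bounded c01 k om Bb.
apply: (cint_bounded (M := Defs.cut d) (B := M * (4 * B%:R / del))).
- exact: cborel_cut_disc.
- by move=> z; exact: ltW.
- exact: cmeasurable_patched.
by move=> z _; exact: (patched_bound e z Hc HB).
Qed.

(** The coefficients [f a b] are constants on the fiber over [b] and come out of each cell integral,
    every summand being integrable. *)
Lemma fpair_qcomb (b : base) mu (F : ix -> qd X n m) (f : ix -> base -> C) :
  (forall a, omega2 d (Base d) (F a)) -> Base d b -> pairable b mu ->
  fpair d b mu (qcomb f F) = \sum_a f a b * fpair d b mu (F a).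
Proof.
move=> om Bb pm.
have Ho i : outer_term i b mu (qcomb f F) = \sum_a f a b * outer_term i b mu (F a).
  rewrite -area_int_sum.
  - apply: eq_area_int => z _; rewrite /outer_density /= mulr_sumr.
    by apply: eq_bigr => a _; rewrite mulrCA.
  - exact: cborel_outer_cell.
  - by move=> a; exact: cint_outer.
have Hn e k : node_term e k b mu (qcomb f F) = \sum_a f a b * node_term e k b mu (F a).
  rewrite node_termE; under [RHS]eq_bigr do rewrite node_termE.
  rewrite -area_int_sum.
  - apply: eq_area_int => z _; rewrite /patched; case: asboolP => _; last first.
      by rewrite big1// => a _; rewrite mulr0.
    rewrite /node_density.
    have -> : node_coef e k (qcomb f F) z b = \sum_a f a b * node_coef e k (F a) z b.
      by rewrite /node_coef; case: e.
    rewrite mulr_sumr mulr_suml mulr_sumr; apply: eq_bigr => a _.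
    by move: (z ^+ 2)^-1 (f a b) (node_coef _ _ _ _ _) (mn _ _ _ _) => u v x y; ring.
  - exact: cborel_cut_disc.
  - by move=> a; exact: cint_node.
rewrite fpairE.
under eq_bigr do rewrite Ho.
under [X in _ + X]eq_bigr do rewrite !Hn -big_split /=.
rewrite exchange_big /= [X in _ + X]exchange_big /= -big_split /=.
apply: eq_bigr => a _; rewrite fpairE mulrDr !mulr_sumr; congr (_ + _).
by apply: eq_bigr => k _; rewrite mulrDr.
Qed.

End Pairing.

(** * Limits of the pairing *)

Section Convergence.
Set Implicit Arguments.
Unset Strict Implicit.

(** Dominated convergence concerns sequences, whereas the limits sought are along [nbhs p]. If such
    a limit failed, points of [P] in the balls of radius 1/(k+1) would form a sequence violating
    it. *)
Lemma cvg_near_seq (R : realType) (T : pseudoMetricType (Cx R)) (p : T) (P : set T)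
    (f : T -> Cx R) (l : Cx R) : nbhs p P ->
  (forall u : nat -> T, (forall k, P (u k)) -> u @ \oo --> p -> f (u k) @[k --> \oo] --> l) ->
  f @ p --> l.
Proof.
move=> nP H; apply/(@cvgrPdist_lt _ _ _ (nbhs p)) => e e0; apply: contrapT => nH.
have step (k : nat) : exists b, [/\ P b, ball p (k.+1%:R^-1) b & ~ (`|l - f b| < e)].
  apply: contrapT => nb; apply: nH.
  have k0 : (0 : Cx R) < k.+1%:R^-1 by rewrite invr_gt0 ltr0n.
  have n2 : nbhs p (P `&` ball p (k.+1%:R^-1)) by exact: (filterI nP (nbhsx_ballx p _ k0)).
  apply: (@filterS _ (nbhs p) _ _ _ _ n2) => b [Pb pb].
  by apply: contrapT => nl; apply: nb; exists b.
have [u Hu] := choice step.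
have up : u @ \oo --> p.
  apply/cvg_ballP => r /invn_ltC[N Nr]; exists N => // k /= Nk.
  have [_ pu _] := Hu k.
  apply: le_ball pu; apply: le_trans (ltW Nr).
  by rewrite lef_pV2 ?posrE ?ltr0n// ler_nat ltnS.
have fu : f (u k) @[k --> \oo] --> l by apply: H up => k; have [] := Hu k.
have /(@cvgrPdist_lt _ _ _ \oo) /(_ e e0) [N _ HN] := fu.
by have [_ _] := Hu N; apply; apply: (HN N) => /=.
Qed.

Variables (R : realType) (X : surface R) (n m : nat) (d : st_data X n m).
Local Notation C := (Cx R).
Local Notation base := ('rV[C]_n * 'rV[C]_m)%type.
Local Notation c := (rc (Defs.cst d)).
Local Notation ix := ('I_n + 'I_m)%type.
Hypothesis c01 : 0 < Defs.cst d < 1.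
Hypothesis lc : local_coordinates d.

Lemma pairable_ks b h : L_form d (nu d h) -> pairable d b (ks_s d h).
Proof.
move=> [_ sm _].
have cn i x : dom i x -> {for zc i x, continuous (nu d h i \o zinv i)}.
  by move=> dx; case: (sm i 0%N) => + _; apply; exists x.
split.
- move=> i; apply: cmeasurable_continuous; first exact: cborel_outer_chart.
  by move=> _ [x [dx _] <-]; exact: cn.
- move=> i; have [|N HN] := @compact_norm_bounded R _ _ (nu d h i) (core_far_compact lc (i := i)).
    move=> x /(core_far_outer c01)[_ dx].
    apply: (@continuous_near _ _ _ (fun y => (nu d h i \o zinv i) (zc i y))).
      exact: coef_cont (cn _ _ dx).
    have nd : \forall y \near x, dom i y by apply: open_nbhs_nbhs; split => //; exact: dom_open.
    by apply: filterS nd => y dy /=; rewrite zcK.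
  by exists N%:R.
- by move=> e k; exact: cmeasurable_cst.
(* These differentials vanish on the node pieces, so 0 is a bound and any positive [del] serves. *)
- move=> k; exists 0, 1; split => // e z _ /=.
  by rewrite normr0; split => //; left.
Qed.

Lemma is_fbeltrami_pairable b mu : is_fbeltrami d b mu ->
  (forall k, exists M del, node_ctrl d k b mu M del) -> pairable d b mu.
Proof.
move=> [_ _ _ [mm mn] [M [HM _]]] ctl; split => // i.
by exists M => x /(core_far_outer c01)[ox dx]; exact: HM.
Qed.

Lemma le_norm_bound (x y : C) : `|x| <= y -> `|x| <= `|y|.
Proof. by move=> xy; rewrite (ger0_norm (le_trans (normr_ge0 x) xy)). Qed.

Lemma half_node_small (eps : R) k (b : base) (z : C) : `|z| < rc eps -> z != 0 ->
  `|tk k b| <= `|z| ^+ 2 -> `|tk k b| < rc eps * `|z|.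
Proof.
by move=> ze z0 tz; apply: le_lt_trans tz _; rewrite expr2 ltr_pM2r ?normr_gt0.
Qed.

Lemma vanish_or_le (eps : R) (x : C) (z : C) : 0 < eps ->
  (`|z| < rc eps -> x = 0) -> x = 0 \/ rc eps ^+ 2 <= `|z| ^+ 2.
Proof.
move=> e0 H; have e0' : (0 : C) < rc eps by rewrite -[0]/(rc 0) ltr_rc.
have [le|lt] := real_leP (gtr0_real e0') (normr_real z); last by left; exact: H.
by right; rewrite lerXn2r// nnegrE // ltW.
Qed.

(** At a node, [mu] vanishes for |z| < eps, whence [del] = eps^2; where the node is opened, the half
    itself satisfies |z|^2 >= |t_k|. *)
Lemma off_nodes_ctrl b mu k : is_fbeltrami d b mu -> off_nodes d b mu ->
  exists M del, node_ctrl d k b mu M del.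
Proof.
move=> [_ _ _ _ [M [_ HM]]] [eps e0 He].
have e0' : (0 : C) < rc eps by rewrite -[0]/(rc 0) ltr_rc.
have [t0|t0] := eqVneq (tk k b) 0.
  exists `|M|, (rc eps ^+ 2); split => //; first by rewrite exprn_gt0.
  move=> e z pz; have az := punctured_half_annulus c01 pz.
  split; first exact/le_norm_bound/HM.
  by apply: vanish_or_le => // ze; exact: He.
exists `|M|, `|tk k b|; split => //; first by rewrite normr_gt0.
move=> e z pz; have az := punctured_half_annulus c01 pz.
split; first exact/le_norm_bound/HM.
by right; case: pz => /half_nodeP[].
Qed.

Lemma pairable_off_nodes b mu : is_fbeltrami d b mu -> off_nodes d b mu -> pairable d b mu.
Proof. by move=> im om; apply: is_fbeltrami_pairable => // k; exact: off_nodes_ctrl. Qed.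

Variables (U : set base) (p : base) (M : base -> fbeltrami X m) (mu : fbeltrami X m).
Hypotheses (Bp : Base d p) (nU : nbhs p U) (UB : U `<=` Base d).
Hypothesis (cM : fbel_converges d U p M mu).

(** The control must be uniform near p, although a node of p may open at b. On a half, |z| < eps
    gives |t_k(b)| <= |z|^2 < eps |z|, exactly the range where the family is required to vanish. If
    t_k(p) is nonzero, |t_k(b)| stays above half of |t_k(p)|. *)
Lemma fbel_converges_ctrl k : exists K del,
  \forall b \near p, U b /\ node_ctrl d k b (M b) K del.
Proof.
case: cM => _ [K HK] [eps e0 He] _ _.
have e0' : (0 : C) < rc eps by rewrite -[0]/(rc 0) ltr_rc.
have [t0|t0] := eqVneq (tk k p) 0.
  exists `|K|, (rc eps ^+ 2); apply: filterS nU => b Ub; split => //.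
  split => //; first by rewrite exprn_gt0.
  move=> e z pz; have az := punctured_half_annulus c01 pz.
  split; first by apply: le_norm_bound; case: (HK b Ub) => _; apply.
  apply: vanish_or_le => // ze; apply: (He b) => //.
  by case: pz => /half_nodeP[tz _] z0; exact: half_node_small.
have h : `|tk k p| / 2 < `|tk k p|.
  by rewrite ltr_pdivrMr// mulr_natr mulr2n ltrDl normr_gt0.
exists `|K|, (`|tk k p| / 2).
have n1 : \forall b \near p, `|tk k p| / 2 < `|tk k b|.
  exact: (cvg_norm_gt (@continuous_tk R n m k p) h).
apply: filterS2 nU n1 => b Ub tb; split => //.
split => //; first by rewrite divr_gt0 ?normr_gt0.
move=> e z pz; have az := punctured_half_annulus c01 pz.
split; first by apply: le_norm_bound; case: (HK b Ub) => _; apply.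
by right; case: pz => /half_nodeP[tz _] _; exact: le_trans (ltW tb) tz.
Qed.

Lemma fbel_converges_pairable : \forall b \near p, pairable d b (M b).
Proof.
have H : \forall b \near p, forall k : 'I_m, exists K del, node_ctrl d k b (M b) K del.
  apply: (@filter_forall _ _ (fun k b => exists K del, node_ctrl d k b (M b) K del)
    (nbhs p) _) => k.
  have [K [del HK]] := fbel_converges_ctrl k.
  by apply: filterS HK => b [_ h]; exists K, del.
apply: filterS2 nU H => b Ub hb; apply: is_fbeltrami_pairable => //.
by case: cM => + _ _ _ _; exact.
Qed.

Hypothesis bmu : is_fbeltrami d p mu.

Lemma outer_term_cvg i psi : omega2 d (Base d) psi ->
  outer_term d i b (M b) psi @[b --> p] --> outer_term d i p mu psi.
Proof.
move=> om; have [N HN] := outer_cell_bounded d i.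
have [B HB] := qo_bounded c01 lc i om Bp.
case: (cM) => bM [K HK] _ cmo _.
have nP : \forall b \near p, U b /\ forall x, core_far d i x -> `|qo psi i x b| <= B%:R.
  exact: (filterI nU HB).
apply: (cvg_near_seq nP) => u Pu up.
apply: (area_int_dct (N := set0) (M := N%:R) (B := K * B%:R)).
- exact: cborel_outer_cell.
- exact: HN.
- move=> k; have [Uk _] := Pu k; case: (bM _ Uk) => _ _ _ [mm _] _.
  by apply: cmeasurable_outer_density => //; exact: UB.
- by case: bmu => _ _ _ [mm _] _; exact: cmeasurable_outer_density.
- exact: negligible_set0.
- move=> _ [x cx <-] _; have [ox dx] := core_far_outer c01 (outer_cell_far c01 cx).
  rewrite /outer_density zcK//.
  have l1 : mo (M (u k)) i x @[k --> \oo] --> mo mu i x.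
    exact: (cvg_comp _ _ up (cmo i x ox dx)).
  have l2 : qo psi i x (u k) @[k --> \oo] --> qo psi i x p.
    have H : (x, u k) @[k --> \oo] --> (x, p) by exact: (cvg_pairT (@cvg_cst _ x _ \oo _) up).
    exact: (cvg_comp _ _ H (continuous_qo om ox dx Bp)).
  exact: (cvgM l1 l2).
move=> k _ [x cx <-]; have fx := outer_cell_far c01 cx.
have [ox dx] := core_far_outer c01 fx; have [Uk Bk] := Pu k.
rewrite /outer_density zcK// normrM ler_pM// ?Bk//.
by case: (HK _ Uk) => + _; apply.
Qed.

(** Off the circle |z|^2 = |t_k(p)|, membership of z in the half is locally constant in the base
    point: inside the half both factors converge, outside it all values are 0. *)
Lemma patched_cvg e k psi z : omega2 d (Base d) psi -> cut_disc d z ->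
  `|z| ^+ 2 != `|tk k p| ->
  patched d e k b (M b) psi z @[b --> p] --> patched d e k p mu psi z.
Proof.
move=> om zc zt.
have r2 : `|z| ^+ 2 \is Num.real by rewrite realX// normr_real.
have [_ cutc _] := cut_bounds c01.
have ct : tk k b @[b --> p] --> tk k p := @continuous_tk R n m k p.
have [le|gt] := real_leP (normr_real (tk k p)) r2.
  have lt : `|tk k p| < `|z| ^+ 2 by rewrite lt_neqAle eq_sym zt le.
  have z0 : z != 0.
    apply/eqP => z0; move: lt; rewrite z0 normr0 expr0n /=.
    by move=> /(le_lt_trans (normr_ge0 _)); rewrite ltxx.
  have ph b : `|tk k b| < `|z| ^+ 2 -> punctured_half d e k b z.
    by move=> tb; split => //; case: e; split => //; exact: ltW.
  have -> : patched d e k p mu psi z = node_density e k p mu psi z.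
    by rewrite /patched; case: asboolP => // -[]; exact: ph.
  have n1 : \forall b \near p, `|tk k b| < `|z| ^+ 2 by exact: (cvg_norm_lt ct lt).
  have n2 : {near p, (fun b => node_density e k b (M b) psi z) =1
                     (fun b => patched d e k b (M b) psi z)}.
    apply: filterS n1 => b tb; rewrite /patched; case: asboolP => // -[]; exact: ph.
  apply: cvg_trans (near_eq_cvg n2) _.
  have l1 : mn (M b) e k z @[b --> p] --> mn mu e k z.
    by case: cM => _ _ _ _; apply => //; exact: lt_trans zc cutc.
  have l2 : node_coef e k psi z b @[b --> p] --> node_coef e k psi z p.
    have az := punctured_half_annulus c01 (ph _ lt).
    have H : (z, b) @[b --> p] --> (z, p).
      exact: (cvg_pairT (@cvg_cst _ z _ (nbhs p) _) (@cvg_id _ (nbhs p))).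
    exact: (cvg_comp _ _ H (node_coef_cont (e := e) (y := (z, p)) om Bp erefl az)).
  exact: (cvgM l1 (cvgM (cvgMl_tmp (a := (4 : C)) l2) (@cvg_cst _ (z ^+ 2)^-1 _ (nbhs p) _))).
have n0 b mu' : `|z| ^+ 2 < `|tk k b| -> patched d e k b mu' psi z = 0.
  move=> tb; rewrite /patched; case: asboolP => // -[/half_nodeP[tz _] _].
  by have := lt_le_trans tb tz; rewrite ltxx.
rewrite (n0 p mu gt).
have n1 : \forall b \near p, `|z| ^+ 2 < `|tk k b| by exact: (cvg_norm_gt ct gt).
have n2 : {near p, (fun=> 0) =1 (fun b => patched d e k b (M b) psi z)}.
  by apply: filterS n1 => b tb; rewrite (n0 _ _ tb).
exact: cvg_trans (near_eq_cvg n2) (@cvg_cst _ (0 : C) _ (nbhs p) _).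
Qed.

Lemma node_term_cvg e k psi : omega2 d (Base d) psi ->
  node_term d e k b (M b) psi @[b --> p] --> node_term d e k p mu psi.
Proof.
move=> om; have [B HB] := node_coef_bounded c01 k om Bp.
have [K [del HK]] := fbel_converges_ctrl k.
case: (cM) => bM _ _ _ _.
have nP : \forall b \near p, (U b /\ node_ctrl d k b (M b) K del) /\
    forall e z, punctured_half d e k b z -> `|node_coef e k psi z b| <= B%:R.
  exact: (filterI HK HB).
rewrite node_termE; under eq_fun do rewrite node_termE.
apply: (cvg_near_seq nP) => u Pu up.
apply: (area_int_dct (N := [set q | `|ofplane q : C| ^+ 2 = `|tk k p|])
  (M := Defs.cut d) (B := K * (4 * B%:R / del))).
- exact: cborel_cut_disc.
- by move=> z; exact: ltW.
- move=> j; have [[Uj _] _] := Pu j; case: (bM _ Uj) => _ _ _ [_ mm] _.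
  by apply: cmeasurable_patched => //; exact: UB.
- by case: bmu => _ _ _ [_ mm] _; exact: cmeasurable_patched.
- exact: circle_negligible.
- move=> z zc /=; rewrite toplaneK => /eqP zt.
  exact (cvg_comp u (fun b => patched d e k b (M b) psi z) up (patched_cvg om zc zt)).
move=> j z _; have [[_ ctl] Bj] := Pu j; exact: patched_bound ctl Bj.
Qed.

Lemma fpair_cvg psi : omega2 d (Base d) psi ->
  fpair d b (M b) psi @[b --> p] --> fpair d p mu psi.
Proof.
move=> om; rewrite fpairE; under eq_fun do rewrite fpairE.
apply: (@cvgD _ _ _ (nbhs p)).
  by apply: cvg_sumC => i; exact: outer_term_cvg.
apply: cvg_sumC => k; apply: (@cvgD _ _ _ (nbhs p)); exact: node_term_cvg.
Qed.

End Convergence.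

(** * The second frame *)

Section Cotangent.
Set Implicit Arguments.
Unset Strict Implicit.
Variables (R : realType) (X : surface R) (n m : nat) (d : st_data X n m).
Local Notation C := (Cx R).
Local Notation base := ('rV[C]_n * 'rV[C]_m)%type.
Local Notation c := (rc (Defs.cst d)).
Local Notation ix := ('I_n + 'I_m)%type.
Local Notation cov := (covec R n m).

Definition coord (xi : cov) (a : ix) : C :=
  match a with inl j => xi.1 0 j | inr k => xi.2 0 k end.

Definition covec_of (f : ix -> C) : cov := (\row_j f (inl j), \row_k f (inr k)).

Definition unit_covec (a : ix) : cov :=
  match a with inl j => (delta_mx 0 j, 0) | inr k => (0, delta_mx 0 k) end.

Lemma coordK xi : covec_of (coord xi) = xi.
Proof. by case: xi => x y; congr pair; apply/rowP => j; rewrite mxE. Qed.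

Lemma covec_ofK f a : coord (covec_of f) a = f a.
Proof. by case: a => j /=; rewrite mxE. Qed.

Lemma coord_eq xi eta : (forall a, coord xi a = coord eta a) -> xi = eta.
Proof.
move=> h; rewrite -(coordK xi) -(coordK eta) (_ : coord xi = coord eta)//.
exact/funext.
Qed.

Lemma coord_lin (x : C) (xi eta : cov) a :
  coord (x *: xi.1 + eta.1, x *: xi.2 + eta.2) a = x * coord xi a + coord eta a.
Proof. by case: a => j /=; rewrite !mxE. Qed.

Lemma coordD (xi eta : cov) a : coord (xi + eta) a = coord xi a + coord eta a.
Proof. by case: a => j /=; rewrite mxE. Qed.

Lemma coordZ (x : C) (xi : cov) a : coord (x *: xi) a = x * coord xi a.
Proof. by case: a => j /=; rewrite mxE. Qed.

Lemma coord_unit a a' : coord (unit_covec a) a' = (a == a')%:R.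
Proof. by case: a a' => [j|k] [j'|k'] /=; rewrite !mxE ?eqxx //= eq_sym. Qed.

Lemma coord_sum (r : seq ix) (f : ix -> cov) a :
  coord (\sum_(i <- r) f i) a = \sum_(i <- r) coord (f i) a.
Proof.
elim: r => [|i r IH]; first by rewrite !big_nil; case: a => j /=; rewrite mxE.
by rewrite !big_cons coordD IH.
Qed.

Lemma covec_of_sum f : covec_of f = \sum_a f a *: unit_covec a.
Proof.
apply: coord_eq => a; rewrite covec_ofK coord_sum (bigD1 a)//= coordZ coord_unit eqxx mulr1.
rewrite big1 ?addr0// => a' aa'; by rewrite coordZ coord_unit (negbTE aa') mulr0.
Qed.

Lemma differentiable_coord_covec (a : ix) (xi : cov) :
  differentiable (fun xi : cov => (coord xi a : C^o)) xi.
Proof.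
case: a => j /=.
  have d1 : differentiable (fst : cov -> 'rV[C]_n) xi.
    by apply: linear_differentiable => y; exact: cvg_fst.
  exact: (differentiable_comp d1 (differentiable_coord xi.1 0 j)).
have d2 : differentiable (snd : cov -> 'rV[C]_m) xi.
  by apply: linear_differentiable => y; exact: cvg_snd.
exact: (differentiable_comp d2 (differentiable_coord xi.2 0 j)).
Qed.

Lemma hol_on_coord U (al : base -> cov) a : hol_form U al -> hol_on U (fun b => coord (al b) a).
Proof.
move=> hal b Ub; exact: (differentiable_comp (hal b Ub) (differentiable_coord_covec a _)).
Qed.

Lemma hol_form_sum U (r : seq ix) (f : ix -> base -> C) : (forall a, hol_on U (f a)) ->
  hol_form U (fun b => \sum_(a <- r) f a b *: unit_covec a).
Proof.
move=> hf; elim: r => [|a r IH] b Ub.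
  under eq_fun do rewrite big_nil; exact: differentiable_cst.
under eq_fun do rewrite big_cons.
apply: differentiableD; last exact: IH.
exact: (differentiableZl (unit_covec a) (hf a b Ub)).
Qed.

Lemma hol_on_cst (U : set base) (x : C) : hol_on U (fun=> x).
Proof. by move=> b _; exact: differentiable_cst. Qed.

Lemma qd_eq_trans U (x y z : qd X n m) : qd_eq d U x y -> qd_eq d U y z -> qd_eq d U x z.
Proof.
move=> xy yz b Ub; have [a1 a2] := xy b Ub; have [b1 b2] := yz b Ub; split.
  by move=> i w ow dw; rewrite a1// b1.
by move=> k z' w h; rewrite a2// b2.
Qed.

Lemma qd_eq_sym U (x y : qd X n m) : qd_eq d U x y -> qd_eq d U y x.
Proof.
move=> xy b Ub; have [a1 a2] := xy b Ub; split.
  by move=> i w ow dw; rewrite a1.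
by move=> k z' w h; rewrite a2.
Qed.

(** A difference of combinations is the combination of the differences, so congruence modulo [spanI]
    means that coefficients can be chosen to agree at [p]. *)
Lemma coset_repr U p (F : ix -> qd X n m) psi chi f : (forall a, hol_on U (f a)) ->
  qd_eq d U psi (qcomb f F) ->
  coset d U p F psi chi <->
  exists2 g, forall a, hol_on U (g a) & qd_eq d U chi (qcomb g F) /\ forall a, g a p = f a p.
Proof.
move=> hf psif; split.
  move=> [_ [h hh E]]; exists (fun a b => f a b + h a b).
    by move=> a b Ub; apply: differentiableD; [exact: hf|case: (hh a) => + _; apply].
  split; last by move=> a; case: (hh a) => _ ->; rewrite addr0.
  move=> b Ub; have [e1 e2] := E b Ub; have [f1 f2] := psif b Ub; split.
    move=> i x ox dx; have := e1 i x ox dx; rewrite /= f1// mulN1r => /eqP.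
    rewrite subr_eq => /eqP ->; rewrite addrC -big_split; apply: eq_bigr => a _.
    by rewrite mulrDl.
  move=> k z w zw; have := e2 k z w zw; rewrite /= f2// mulN1r => /eqP.
  rewrite subr_eq => /eqP ->; rewrite addrC -big_split; apply: eq_bigr => a _.
  by rewrite mulrDl.
move=> [g hg [E gf]]; split; first by exists g.
exists (fun a b => g a b - f a b).
  move=> a; split; last by rewrite gf subrr.
  by move=> b Ub; apply: differentiableB; [exact: hg|exact: hf].
move=> b Ub; have [e1 e2] := E b Ub; have [f1 f2] := psif b Ub; split.
  move=> i x ox dx; rewrite /= e1// f1// mulN1r /= -sumrB; apply: eq_bigr => a _.
  by rewrite mulrBl.
move=> k z w zw; rewrite /= e2// f2// mulN1r /= -sumrB; apply: eq_bigr => a _.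
by rewrite mulrBl.
Qed.

Hypothesis c01 : 0 < Defs.cst d < 1.
Hypothesis lc : local_coordinates d.
Hypothesis radc : Defs.rad d <= Defs.cst d ^+ 4.
Hypothesis nuL : forall j, L_form d (nu d j).

(** At z = w = t_k = 0 both series reduce to their term a_00, as 0^0 = 1. *)
Lemma laur_residue k psi (b : base) l : is_laur d k psi b l -> tk k b = 0 ->
  l = 4 * qn psi k 0 0 b.
Proof.
move=> [a Ha al] t0.
have hC : hausdorff_space C by exact: norm_hausdorff.
(* The index is shifted by one because the partial sum for N = 0 is empty and lacks a_00. *)
have cS : S @ \oo --> \oo.
  by rewrite (_ : S = addn^~ 1%N); [exact: cvg_addnr|apply/funext => N; rewrite addn1].
have nd : in_node d k b 0 0 by split; rewrite ?normr0 ?mulr0 ?t0 ?cst_gt0.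
have [_ cq] := Ha _ _ nd.
have E1 : (fun N => 4 * \sum_(p < N.+1) a p p * tk k b ^+ p) @ \oo --> 4 * a 0%N 0%N.
  rewrite (_ : (fun N => _) = (fun=> 4 * a 0%N 0%N)); first exact: cvg_cst.
  apply/funext => N; rewrite big_ord_recl expr0 mulr1 big1 ?addr0// => i _.
  by rewrite t0 expr0n mulr0.
have E2 : (fun N => \sum_(p < N.+1) \sum_(q < N.+1) a p q * 0 ^+ p * 0 ^+ q) @ \oo --> a 0%N 0%N.
  rewrite (_ : (fun N => _) = (fun=> a 0%N 0%N)); first exact: cvg_cst.
  apply/funext => N; rewrite big_ord_recl big_ord_recl !expr0 !mulr1.
  rewrite big1 ?addr0; last by move=> i _; rewrite expr0n mulr0.
  rewrite big1 ?addr0// => i _; rewrite big1// => j _.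
  by rewrite expr0n mulr0 mul0r.
have -> : l = 4 * a 0%N 0%N.
  apply: (cvg_unique hC) E1; exact: (cvg_comp S _ cS al).
congr (_ * _); apply: (cvg_unique hC E2).
exact: (cvg_comp S _ cS cq).
Qed.

Variable phi : ix -> qd X n m.
Hypothesis Hphi : is_frame d phi.
Local Notation F := (second_frame phi).

Definition frame_laur k (a : ix) (b : base) : C :=
  match a with inl _ => 0 | inr l => tk l b * - ((k == l)%:R / rc pi) end.

Lemma second_frame_omega2 a : omega2 d (Base d) (F a).
Proof. by case: Hphi => om _ _ _; case: a => [j|k] //=; exact: omega2_qscale. Qed.

Lemma second_frame_laur k a b : Base d b -> is_laur d k (F a) b (frame_laur k a b).
Proof.
move=> Bb; case: Hphi => om _ _ /(_ b Bb)[L1 L2].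
have tb := Bb.2 k.
have H a' : is_laur d k (phi a') b (Laur d k (phi a') b).
  by have [_ _ /(_ k b Bb)[l Hl] _] := om a'; rewrite (is_laurE c01 radc tb Hl).
case: a => [j|l] /=; first by rewrite -(L1 k j).
by rewrite -L2; exact: is_laur_qscale.
Qed.

(** On t_k = 0 the residue is a quarter of the Laurent coefficient. It is 0 for the members whose
    k-th coefficient vanishes, and the factor t_k kills it for phi_(n+k). *)
Lemma second_frame_PiV a U : U `<=` Base d -> PiV d U (F a).
Proof.
move=> UB; split; first exact: omega2_sub (second_frame_omega2 a).
move=> k b Ub t0; have Hl := second_frame_laur k a (UB _ Ub).
have := laur_residue Hl t0.
have -> : frame_laur k a b = 0.
  case: a {Hl} => [//|l] /=; case: eqP => [<-|_]; first by rewrite t0 mul0r.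
  by rewrite mul0r oppr0 mulr0.
by move/esym/eqP; rewrite mulf_eq0 pnatr_eq0 /= => /eqP.
Qed.

(** Presents a rescaled member as a combination with one nonzero coefficient, the form to which
    [fpair_qcomb] applies. *)
Lemma qscale_qcomb (g : base -> C) (G : ix -> qd X n m) a b :
  qd_eq_at d b (qscale g (G a)) (qcomb (fun a' b => if a' == a then g b else 0) G).
Proof.
split=> [i x _ _|k z w _] /=; rewrite (bigD1 a)//= eqxx big1 ?addr0// => a' /negbTE ->;
  by rewrite mul0r.
Qed.

(** Duality with the coordinate vectors: the factor t_l of the frame and the constant -1/pi of
    [Laur] cancel against -pi/t_l. *)
Lemma second_frame_pair b v a : Base d b -> smooth_fiber b ->
  tangent_pair d b v (F a) = coord v a.
Proof.
move=> Bb sb; case: Hphi => om _ /(_ b Bb sb)[P1 P2] _.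
have tb k := Bb.2 k.
have LF k : laur_functional d k (F a) b = - rc pi / tk k b * frame_laur k a b.
  by rewrite /laur_functional (is_laurE c01 radc (tb k) (second_frame_laur k a Bb)).
rewrite /tangent_pair; under [X in _ + X]eq_bigr do rewrite LF.
case: a {LF} => [j|l] /=.
  rewrite [X in _ + X]big1 ?addr0; last by move=> k _; rewrite !mulr0.
  under eq_bigr do rewrite P1; rewrite (bigD1 j)//= eqxx mulr1 big1 ?addr0// => h /negbTE ->.
  by rewrite mulr0.
rewrite big1 ?add0r; last first.
  move=> h _; rewrite (eq_fpair c01 _ (qscale_qcomb _ _ _ _)).
  rewrite fpair_qcomb//; last exact: pairable_ks.
  rewrite big1 ?mulr0// => a' _; case: eqP => [->|_]; last by rewrite mul0r.
  by rewrite P2 mulr0.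
have pi0 : rc pi != 0 :> C by rewrite gt_eqF// -[0]/(rc 0) ltr_rc pi_gt0.
rewrite (bigD1 l)//= eqxx big1 ?addr0; last first.
  by move=> k /negbTE ->; rewrite mul0r oppr0 !mulr0.
have := sb l; move: pi0; rewrite (_ : true%:R = 1 :> C)//.
move: (rc pi : C) (tk l b) (v.2 0 l) => u t x u0 t0.
by field; rewrite u0 t0.
Qed.

(** All t_k are shifted by 1/(N+1): those equal to 0 become nonzero at once, the others stay nonzero
    once 1/(N+1) < |t_k|. *)
Lemma smooth_fiber_dense (b : base) : exists2 u : nat -> base,
  u @ \oo --> b & \forall N \near \oo, smooth_fiber (u N).
Proof.
pose e (N : nat) : C := N.+1%:R^-1.
have e0 : e @ \oo --> (0 : C).
  apply/cvgrPdist_lt => r /invn_ltC[N Nr]; exists N => // k /= Nk.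
  rewrite sub0r normrN ger0_norm ?invr_ge0// (le_lt_trans _ Nr)//.
  by rewrite lef_pV2 ?posrE ?ltr0n// ler_nat ltnS.
exists (fun N => (b.1, b.2 + const_mx (e N))).
  case: b => b1 b2 /=.
  suff c2 : b2 + const_mx (e N) @[N --> \oo] --> b2.
    exact (cvg_pairT (@cvg_cst _ b1 _ \oo _) c2).
  have E : (fun N => b2 + const_mx (e N)) = (fun N => b2 + e N *: const_mx 1).
    by apply/funext => N; congr (_ + _); apply/rowP => j; rewrite !mxE mulr1.
  have c1 : (fun=> const_mx 1 : 'rV[C]_m) @ \oo --> (const_mx 1 : 'rV[C]_m) by exact: cvg_cst.
  rewrite E; have := cvgD (@cvg_cst _ b2 _ \oo _) (cvgZ e0 c1).
  by rewrite scale0r addr0; apply.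
apply: filter_forall => l.
rewrite /tk /=.
have [t0|t0] := eqVneq (b.2 0 l) 0.
  by apply: nearW => N; rewrite !mxE t0 add0r invr_eq0 pnatr_eq0.
have h : `|0 : C| < `|b.2 0 l| by rewrite normr0 normr_gt0.
have n1 : \forall N \near \oo, `|e N| < `|b.2 0 l| by exact: (cvg_norm_lt e0 h).
apply: filterS n1 => N lt; rewrite !mxE; apply/eqP => /eqP; rewrite addr_eq0 => /eqP E.
by move: lt; rewrite E normrN ltxx.
Qed.

End Cotangent.

(** * The cotangent identification *)

Section Identification.
Set Implicit Arguments.
Unset Strict Implicit.
Variables (R : realType) (X : surface R) (n m : nat) (d : st_data X n m).
Local Notation C := (Cx R).
Local Notation base := ('rV[C]_n * 'rV[C]_m)%type.
Local Notation ix := ('I_n + 'I_m)%type.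
Local Notation cov := (covec R n m).
Hypothesis c01 : 0 < Defs.cst d < 1.
Hypothesis lc : local_coordinates d.
Hypothesis radc : Defs.rad d <= Defs.cst d ^+ 4.
Hypothesis nuL : forall j, L_form d (nu d j).
Variable phi : ix -> qd X n m.
Hypothesis Hphi : is_frame d phi.
Local Notation F := (second_frame phi).
Variable Theta : set base -> (base -> cov) -> qd X n m.
Hypothesis HTheta : cotangent_identification d Theta.

Lemma eq_tangent_pair b v psi chi : qd_eq_at d b psi chi ->
  tangent_pair d b v psi = tangent_pair d b v chi.
Proof.
move=> E.
have EF h : v.1 0 h * fpair d b (ks_s d h) psi = v.1 0 h * fpair d b (ks_s d h) chi.
  by rewrite (eq_fpair c01 _ E).
have EL k : v.2 0 k * laur_functional d k psi b = v.2 0 k * laur_functional d k chi b.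
  by rewrite /laur_functional (eq_Laur k E).
exact (congr2 +%R (eq_bigr _ (fun h _ => EF h)) (eq_bigr _ (fun k _ => EL k))).
Qed.

Lemma cot_eval_unit (xi : cov) a : cot_eval xi (unit_covec R a) = coord xi a.
Proof.
rewrite /cot_eval; case: a => [j|k] /=.
  rewrite [X in _ + X]big1 ?addr0; last by move=> k _; rewrite mxE mulr0.
  rewrite (bigD1 j)//= mxE !eqxx mulr1 big1 ?addr0// => h /negbTE hj.
  by rewrite mxE hj andbF mulr0.
rewrite big1 ?add0r; last by move=> k' _; rewrite mxE mulr0.
rewrite (bigD1 k)//= mxE !eqxx mulr1 big1 ?addr0// => h /negbTE hj.
by rewrite mxE hj andbF mulr0.
Qed.

(** The comparison is made on the side of forms, which are continuous maps into a Hausdorff space.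
    Surjectivity of [Theta] gives a form [al] over [F a]; the pairing makes it the unit covector on
    smooth fibers, and density makes it so everywhere. *)
Lemma Theta_unit U a : open U -> U `<=` Base d ->
  qd_eq d U (Theta U (fun=> unit_covec R a)) (F a).
Proof.
move=> oU UB; have [[T1 T2] _ [_ T3] _ T5] := HTheta oU UB.
have [al hal E] := T3 _ (second_frame_PiV c01 radc Hphi a UB).
have alE b : U b -> smooth_fiber b -> al b = unit_covec R a.
  move=> Ub sb; apply: coord_eq => a'; rewrite -cot_eval_unit -(T5 al b)//.
  rewrite (eq_tangent_pair _ (E b Ub)) (second_frame_pair c01 lc radc nuL Hphi)//; last exact: UB.
  by rewrite !coord_unit eq_sym.
apply: qd_eq_trans E; apply: T2 => b Ub; apply/esym.
have [u ub su] := @smooth_fiber_dense R n m b.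
have hV : hausdorff_space cov by exact: norm_hausdorff.
have uU : \forall N \near \oo, U (u N) by apply: ub; apply: open_nbhs_nbhs; split.
have l1 : al (u N) @[N --> \oo] --> al b.
  exact: (cvg_comp _ _ ub (differentiable_continuous (hal b Ub))).
apply: (cvg_unique hV l1).
have near_eq : {near \oo, (fun=> unit_covec R a) =1 (fun N => al (u N))}.
  by apply: filterS2 uU su => N UN sN; rewrite alE.
exact: cvg_trans (near_eq_cvg near_eq) (@cvg_cst _ (unit_covec R a) _ \oo _).
Qed.

(** Induction over the index list by the linearity of [Theta]. [Theta] respects equality of forms on
    [U] only up to [qd_eq], so each rewriting of a form goes through [T2]. *)
Lemma Theta_qcomb U (f : ix -> base -> C) : open U -> U `<=` Base d ->
  (forall a, hol_on U (f a)) ->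
  qd_eq d U (Theta U (fun b => covec_of (f ^~ b))) (qcomb f F).
Proof.
move=> oU UB hf; have [[T1 T2] T4 _ _ _] := HTheta oU UB.
have hunit a : hol_form U (fun=> unit_covec R a) by move=> b _; exact: differentiable_cst.
have h0 : hol_form U (fun=> (0 : cov)) by move=> b _; exact: differentiable_cst.
(* Linearity in the form 1 * 0 + 0 says that the image of 0 equals twice itself. *)
have Theta0 b : U b -> (forall i x, outer d x -> dom i x -> qo (Theta U (fun=> 0)) i x b = 0) /\
    (forall k z w, in_node d k b z w -> qn (Theta U (fun=> 0)) k z w b = 0).
  move=> Ub; have [e1 e2] := T4 (fun=> 1) _ _ (@hol_on_cst R n m U 1) h0 h0 b Ub.
  have S0 : qd_eq d U (Theta U (fun=> 0))
      (Theta U (fun b : base => ((1 : C) *: (0 : cov).1 + (0 : cov).1,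
                                 (1 : C) *: (0 : cov).2 + (0 : cov).2))).
    by apply: T2 => b' _; rewrite /= !scaler0 !addr0.
  have [s1 s2] := S0 b Ub; split.
    move=> i x ox dx; have := e1 i x ox dx; rewrite -s1//= mul1r => /eqP.
    by rewrite -subr_eq0 opprD addrA subrr sub0r oppr_eq0 => /eqP.
  move=> k z w zw; have := e2 k z w zw; rewrite -s2//= mul1r => /eqP.
  by rewrite -subr_eq0 opprD addrA subrr sub0r oppr_eq0 => /eqP.
suff H (r : seq ix) : qd_eq d U (Theta U (fun b => \sum_(a <- r) f a b *: unit_covec R a))
    (Qd (fun i x b => \sum_(a <- r) f a b * qo (F a) i x b)
        (fun k z w b => \sum_(a <- r) f a b * qn (F a) k z w b)).
  apply: qd_eq_trans (H (index_enum _)); apply: T2 => b _; exact: covec_of_sum.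
elim: r => [|a r IH].
  apply: (@qd_eq_trans _ _ _ _ _ _ _ (Theta U (fun=> 0))).
    by apply: T2 => b _; rewrite big_nil.
  move=> b Ub; have [z1 z2] := Theta0 b Ub; split.
    by move=> i x ox dx; rewrite z1//= big_nil.
  by move=> k z w zw; rewrite z2//= big_nil.
have E1 := T4 (f a) _ _ (hf a) (hunit a) (hol_form_sum r hf).
have E0 : qd_eq d U (Theta U (fun b => \sum_(i <- a :: r) f i b *: unit_covec R i))
    (Theta U (fun b => (f a b *: (unit_covec R a).1 + (\sum_(i <- r) f i b *: unit_covec R i).1,
                        f a b *: (unit_covec R a).2 + (\sum_(i <- r) f i b *: unit_covec R i).2))).
  by apply: T2 => b _; rewrite big_cons.
apply: (qd_eq_trans E0); apply: (qd_eq_trans E1).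
move=> b Ub; have [i1 i2] := IH b Ub; have [u1 u2] := Theta_unit a oU UB Ub; split.
  by move=> i x ox dx; rewrite /= big_cons i1// u1.
by move=> k z w zw; rewrite /= big_cons i2// u2.
Qed.

End Identification.

(** * The cotangent space as a quotient, and the two limit pairings *)

Theorem lemma13 (R : realType) (X : surface R) (n m : nat)
  (d : st_data X n m) (Hd : is_st_family d)
  (phi : 'I_n + 'I_m -> qd X n m) (Hphi : is_frame d phi)
  (Theta : set ('rV[Cx R]_n * 'rV[Cx R]_m) ->
           ('rV[Cx R]_n * 'rV[Cx R]_m -> covec R n m) -> qd X n m)
  (HTheta : cotangent_identification d Theta)
  (p : 'rV[Cx R]_n * 'rV[Cx R]_m) (Hp : Base d p) :
  let F := second_frame phi in
  exists iota : set ('rV[Cx R]_n * 'rV[Cx R]_m) -> covec R n m -> set (qd X n m),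
  [/\ forall U, open U -> U `<=` Base d -> U p ->
      [/\ set_bij [set: covec R n m] (quot d U p F) (iota U),
          forall al, hol_form U al -> iota U (al p) = coset d U p F (Theta U al) &
          forall (x : Cx R) xi eta psi chi, iota U xi psi -> iota U eta chi ->
            iota U (x *: xi.1 + eta.1, x *: xi.2 + eta.2)
              (qadd (qscale (fun=> x) psi) chi)],
      forall mu, is_fbeltrami d p mu -> off_nodes d p mu ->
      exists l : covec R n m -> Cx R,
        (forall (x : Cx R) xi eta,
           l (x *: xi.1 + eta.1, x *: xi.2 + eta.2) = x * l xi + l eta) /\
        forall U xi psi, open U -> U `<=` Base d -> U p -> iota U xi psi ->
          fpair d p mu psi = l xi /\
          forall M, fbel_converges d U p M mu ->
            fpair d b (M b) psi @[b --> p] --> l xi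
    & forall k, exists l : covec R n m -> Cx R,
        (forall (x : Cx R) xi eta,
           l (x *: xi.1 + eta.1, x *: xi.2 + eta.2) = x * l xi + l eta) /\
        forall U xi psi, open U -> U `<=` Base d -> U p -> iota U xi psi ->
          laur_functional d k psi b
            @[b --> within [set b | tk k b != 0] (nbhs p)] --> l xi].
Proof.
move=> F.
have [_ lc [nuL _ _] _ [c01 _ /andP[_ radc]]] := Hd.
have hcst (U : set ('rV[Cx R]_n * 'rV[Cx R]_m)) (x : Cx R) : hol_on U (fun=> x).
  exact: hol_on_cst.
(* A cotangent vector is represented by the constant form with that value; its image is the
   combination of the frame with constant coefficients [coord xi]. *)
pose iota U (xi : covec R n m) := coset d U p F (Theta U (fun=> xi)).
have Tcst U (xi : covec R n m) : open U -> U `<=` Base d ->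
    qd_eq d U (Theta U (fun=> xi)) (qcomb (fun a _ => coord xi a) F).
  move=> oU UB.
  have E : qd_eq d U (Theta U (fun=> covec_of (coord xi))) (qcomb (fun a _ => coord xi a) F).
    exact: (Theta_qcomb c01 lc radc nuL Hphi HTheta oU UB (fun a => hcst U (coord xi a))).
  by rewrite coordK in E.
have iotaP U xi chi : open U -> U `<=` Base d -> iota U xi chi <->
    exists2 g, forall a, hol_on U (g a) & qd_eq d U chi (qcomb g F) /\ forall a, g a p = coord xi a.
  by move=> oU UB; exact: (coset_repr p chi (fun a => hcst U (coord xi a)) (Tcst U xi oU UB)).
exists iota; split.
- move=> U oU UB Up; have [[T1 T2] T4 [T3 _] _ _] := HTheta U oU UB.
  split.
  + split.
    * move=> xi _; exists (Theta U (fun=> xi)) => //.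
      by exists (fun a _ => coord xi a); [move=> a; exact: hol_on_cst|exact: Tcst].
    * move=> xi eta _ _ E.
      have : iota U xi (Theta U (fun=> xi)).
        apply/iotaP => //; exists (fun a _ => coord xi a); first by move=> a; exact: hol_on_cst.
        by split => //; exact: Tcst.
      rewrite E => /iotaP[]// g hg [Eg gp]; apply: coord_eq => a; rewrite -gp.
      (* The combination with coefficients [g] is the image of the form with components [g]. By
         injectivity of [Theta] this form is the constant [xi], while its value at [p] is [eta]. *)
      have Eq : qd_eq d U (Theta U (fun=> xi)) (Theta U (fun b => covec_of (g ^~ b))).
        apply: (qd_eq_trans Eg); apply: qd_eq_sym.
        exact: (Theta_qcomb c01 lc radc nuL Hphi HTheta).
      have hform : hol_form U (fun b => covec_of (g ^~ b)).
        rewrite (_ : (fun b => _) = (fun b => \sum_a g a b *: unit_covec R a)).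
          exact: hol_form_sum.
        by apply/funext => b; rewrite covec_of_sum.
      have hx : hol_form U (fun=> xi) by move=> b _; exact: differentiable_cst.
      by rewrite (T3 _ _ hx hform Eq p Up) covec_ofK.
    (* The class of the combination with coefficients [f] comes from the covector of their values at
       [p]. *)
    * move=> _ [psi [f hf E] <-]; exists (covec_of (f ^~ p)) => //.
      apply/funext => chi; apply/propext.
      apply: (iff_trans (iotaP U _ chi oU UB)); apply: iff_sym.
      apply: (iff_trans (coset_repr p chi hf E)).
      split=> -[g hg [Eg gp]]; exists g => //; split => // a; rewrite gp covec_ofK//.
  + move=> al hal; apply/funext => chi; apply/propext.
    apply: (iff_trans (iotaP U _ chi oU UB)); apply: iff_sym.
    have hc a : hol_on U (fun b => coord (al b) a) by exact: hol_on_coord.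
    apply: (coset_repr p chi hc).
    have E : qd_eq d U (Theta U (fun b => covec_of (coord (al b))))
        (qcomb (fun a b => coord (al b) a) F).
      exact: (Theta_qcomb c01 lc radc nuL Hphi HTheta oU UB hc).
    by rewrite (_ : (fun b => covec_of (coord (al b))) = al) in E;
      [exact: E|apply/funext => b; rewrite coordK].
  + move=> x xi eta psi chi /iotaP[]// g hg [Eg gp] /iotaP[]// h hh [Eh hp].
    apply/iotaP => //; exists (fun a b => x * g a b + h a b).
      move=> a b Ub; apply: differentiableD; last exact: hh.
      by apply: differentiableM; [exact: differentiable_cst|exact: hg].
    split; last by move=> a; rewrite gp hp coord_lin.
    move=> b Ub; have [g1 g2] := Eg b Ub; have [h1 h2] := Eh b Ub; split.
      move=> i w ow dw; rewrite /= g1// h1//= mulr_sumr -big_split; apply: eq_bigr => a _.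
      by rewrite mulrDl mulrA.
    move=> k z w zw; rewrite /= g2// h2//= mulr_sumr -big_split; apply: eq_bigr => a _.
    by rewrite mulrDl mulrA.
(* The functional is determined by its values on the frame over [p]; any representative has
   coefficients equal to [coord xi] at [p]. *)
- move=> mu bmu omu; exists (fun xi => \sum_a coord xi a * fpair d p mu (F a)).
  have om a := second_frame_omega2 Hphi a.
  split.
    move=> x xi eta; rewrite mulr_sumr -big_split; apply: eq_bigr => a _.
    by rewrite coord_lin mulrDl mulrA.
  move=> U xi psi oU UB Up /iotaP[]// g hg [Eg gp].
  have lE : \sum_a coord xi a * fpair d p mu (F a) = \sum_a g a p * fpair d p mu (F a).
    by apply: eq_bigr => a _; rewrite gp.
  rewrite lE; split.
    rewrite (eq_fpair c01 _ (Eg p Up)) (fpair_qcomb c01 lc)//.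
    exact: pairable_off_nodes.
  move=> M cM; have nU : nbhs p U by apply: open_nbhs_nbhs.
  (* Near [p] the pairing is expanded in the frame, so that the limit splits into limits of
     coefficients and of frame pairings. *)
  have near_eq : {near p, (fun b => \sum_a g a b * fpair d b (M b) (F a)) =1
      (fun b => fpair d b (M b) psi)}.
    apply: filterS2 nU (fbel_converges_pairable c01 nU cM) => b Ub pb.
    rewrite (eq_fpair c01 _ (Eg b Ub)) (fpair_qcomb c01 lc)//; exact: UB.
  apply: cvg_trans (near_eq_cvg near_eq) _.
  apply: cvg_sumC => a.
  have cg : g a b @[b --> p] --> g a p := differentiable_continuous (hg a p Up).
  exact: (cvgM cg (fpair_cvg c01 lc Hp nU UB cM bmu (om a))).
- move=> k; exists (fun xi => coord xi (inr k)); split.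
    by move=> x xi eta; rewrite coord_lin.
  move=> U xi psi oU UB Up /iotaP[]// g hg [Eg gp]; rewrite -gp.
  have nU : nbhs p U by apply: open_nbhs_nbhs.
  have cg : g (inr k) b @[b --> p] --> g (inr k) p.
    exact: (differentiable_continuous (hg (inr k) p Up)).
  have pi0 : rc pi != 0 :> Cx R by rewrite gt_eqF// -[0]/(rc 0) ltr_rc pi_gt0.
  (* Only t_k has to be nonzero, so the limit may be taken along points where other nodes persist.
     There the functional reads off a coefficient, which is continuous at [p]. *)
  have E b : U b -> tk k b != 0 -> laur_functional d k psi b = g (inr k) b.
    move=> Ub t0; rewrite /laur_functional (eq_Laur k (Eg b Ub)).
    have tb := (UB b Ub).2 k.
    have Hl a := second_frame_laur c01 radc Hphi k a (UB b Ub).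
    rewrite (is_laurE c01 radc tb (is_laur_qcomb g Hl)).
    rewrite (bigD1 (inr k))//= eqxx big1 ?addr0; last first.
      move=> [j _|l lk] /=; first by rewrite mulr0.
      rewrite (_ : (k == l) = false) ?mul0r ?oppr0 ?mulr0//.
      by apply/negbTE; apply: contra lk => /eqP ->.
    move: pi0 t0; rewrite (_ : true%:R = 1 :> Cx R)//.
    move: (rc pi : Cx R) (tk k b) (g (inr k) b) => u t x u0 t0.
    by field; rewrite u0 t0.
  have near_eq : {near within [set b | tk k b != 0] (nbhs p),
      g (inr k) =1 (fun b => laur_functional d k psi b)}.
    by apply: filterS nU => b Ub t0; rewrite E.
  apply: cvg_trans (near_eq_cvg near_eq) _.
  exact: cvg_within_filter cg.
Qed.
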